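(* Let $d\ge2$, let $\mathcal{A}=\{A_1,\ldots,A_d\}$ be a simultaneously diagonalizable commuting family of matrices $A_k\in\mathbb{C}^{n\times n}$, let $\boldsymbol\lambda=(\lambda_1,\ldots,\lambda_d)$ be a semisimple joint eigenvalue of $\mathcal{A}$ of multiplicity $p$, and let $X=[X_1\ X_2]\in\mathbb{C}^{n\times n}$, $Y=[Y_1\ Y_2]\in\mathbb{C}^{n\times n}$ be invertible matrices (with $X_1,Y_1\in\mathbb{C}^{n\times p}$) such that $$X_1^*X_1=I_p,\qquad Y^*X=I_n,\qquad Y^*A_kX=\begin{bmatrix}\lambda_kI_p&0\\0&A_{22}^{(k)}\end{bmatrix},\quad k=1,\ldots,d,$$ with $A_{22}^{(k)}\in\mathbb{C}^{(n-p)\times(n-p)}$ diagonal. Consider a perturbed family $\{\widetilde A_k=A_k+\epsilon E_k\}_{k=1}^d$ with $\|E_1\|_F^2+\cdots+\|E_d\|_F^2=1$ and $\epsilon>0$. Let $\mu\sim\mathrm{Unif}(\mathbb{S}_{\mathbb{C}}^{d-1})$, and assume that the $p$ eigenvalues of $\widetilde A(\mu)=\sum_k\mu_k\widetilde A_k$ closest to $\lambda(\mu)=\sum_k\mu_k\lambda_k$ remain semisimple. Suppose that $\widetilde X_1=[\widetilde x_1\ \cdots\ \widetilde x_p]$ and $\widetilde Y_1=[\widetilde y_1\ \cdots\ \widetilde y_p]$ contain the corresponding right/left eigenvectors of $\widetilde A(\mu)$, normalized such that $\widetilde Y_1^*\widetilde X_1=I_p$ and the columns of $\widetilde X_1$ have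 norm $1$, and set $\widetilde{\boldsymbol\lambda}^{(i)}_{\mathrm{RQ1}}:=(\widetilde x_i^*\widetilde A_1\widetilde x_i,\ldots,\widetilde x_i^*\widetilde A_d\widetilde x_i)\in\mathbb{C}^d$. Then for every $R>0$ and $i=1,\ldots,p$, $$\mathrm{Prob}\Big(\big\|\widetilde{\boldsymbol\lambda}^{(i)}_{\mathrm{RQ1}}-\boldsymbol\lambda\big\|_2\le(1+\|X_2\|_2\|Y_2\|_2R)\,\epsilon+\mathcal{O}(\epsilon^2)\Big)\ge1-\frac{(n-p)(d-1)d}{R^2}.$$
   Context: A family $\{A_1,\ldots,A_d\}\subset\mathbb{C}^{n\times n}$ is commuting if $A_jA_k=A_kA_j$ for all $j,k$; it is simultaneously diagonalizable if there is an invertible $S$ with all $S^{-1}A_kS$ diagonal. For a commuting family there is a unitary $U=[u_1\ \cdots\ u_n]$ such that all $U^*A_kU$ are upper triangular; the joint eigenvalues are the $n$ $d$-tuples $(u_i^*A_1u_i,\ldots,u_i^*A_du_i)$, $i=1,\ldots,n$. The algebraic multiplicity of a joint eigenvalue $\boldsymbol\lambda$ is the number of times it occurs in this list; its geometric multiplicity is $\dim\bigcap_{k=1}^d\ker(A_k-\lambda_kI_n)$; $\boldsymbol\lambda$ is semisimple if the two are equal. $\mathrm{Unif}(\mathbb{S}_{\mathbb{C}}^{d-1})$ is the uniform distribution on the unit sphere of $\mathbb{C}^d$. $\|\cdot\|_2$ is the Euclidean/spectral norm, $\|\cdot\|_F$ the Frobenius norm. The columns of $\widetilde Y_1$ are left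 eigenvectors: $\widetilde y_i^*\widetilde A(\mu)=\theta_i\widetilde y_i^*$, $\widetilde A(\mu)\widetilde x_i=\theta_i\widetilde x_i$. Interpretation of the mixed probabilistic/asymptotic bound: $\mu$ is drawn first (the $E_k$ being fixed); then there is a constant $C_\mu$, independent of $\epsilon$ but possibly depending on $\mu$, such that the event in question is that the error is at most $(1+\|X_2\|_2\|Y_2\|_2R)\epsilon+C_\mu\epsilon^2$. The assumption on semisimplicity of the perturbed eigenvalues is understood to hold for almost every $\mu$. (With probability one, $\lambda(\mu)$ is not an eigenvalue of $\sum_k\mu_kA_{22}^{(k)}$.) *)

(* Defs.v *)
From HB Require Import structures.
From mathcomp Require Import all_boot all_order all_algebra.
From mathcomp Require Import sesquilinear spectral.
From mathcomp Require Import all_classical all_reals all_analysis.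
From mathcomp Require Import complex.

Set Implicit Arguments.
Unset Strict Implicit.
Unset Printing Implicit Defensive.

Import Order.TTheory GRing.Theory Num.Theory.

Local Open Scope classical_set_scope.
Local Open Scope ring_scope.
Local Open Scope complex_scope.
Local Open Scope sesquilinear_scope.

(* The complex numbers are R[i] for R : realType; M ^t* is the conjugate
   transpose of M. *)

(* On row and column vectors this is the Euclidean norm. *)
Definition frob (R : realType) (m n : nat) (M : 'M[R[i]]_(m, n)) : R :=
  Num.sqrt (\sum_(i < m) \sum_(j < n) ComplexField.Normc.normc (M i j) ^+ 2).

(* The unit ball rather than the unit sphere, so that the norm of a matrix
   with no columns is 0. *)
Definition specnorm (R : realType) (m n : nat) (M : 'M[R[i]]_(m, n)) : R :=
  sup [set frob (M *m v) | v in [set v : 'cV[R[i]]_n | frob v <= 1]].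

(* Its row space is {v^T | M v = 0}; kermx is a left kernel. *)
Definition rker (R : realType) (n : nat) (M : 'M[R[i]]_n) : 'M[R[i]]_n :=
  kermx M^T.

Definition semisimple_eigenvalue (R : realType) (n : nat) (M : 'M[R[i]]_n)
    (z : R[i]) : Prop :=
  eigenvalue M z /\ mup z (char_poly M) = \rank (rker (M - z%:M)).

Section CommutingFamilies.
Context (R : realType) (d n : nat).
Implicit Types (A : 'I_d -> 'M[R[i]]_n) (lam mu : 'rV[R[i]]_d).

Definition commuting_family A : Prop :=
  forall j k, A j *m A k = A k *m A j.

Definition simultaneously_diagonalizable A : Prop :=
  exists2 S : 'M[R[i]]_n, S \in unitmx &
    forall k, is_diag_mx (invmx S *m A k *m S).

(* is_trig_mx means lower triangular, whence the transpose. *)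
Definition unitary_triangularizer A (U : 'M[R[i]]_n) : Prop :=
  U \is unitarymx /\ forall k, is_trig_mx (U ^t* *m A k *m U)^T.

(* The i-th joint eigenvalue read off U, namely (u_i^* A_k u_i)_k. *)
Definition joint_eig A (U : 'M[R[i]]_n) (i : 'I_n) : 'rV[R[i]]_d :=
  \row_k (U ^t* *m A k *m U) i i.

(* For a commuting family a triangularizing U exists, and the count below
   does not depend on it. *)
Definition joint_alg_mult A lam (m : nat) : Prop :=
  exists2 U : 'M[R[i]]_n, unitary_triangularizer A U &
    #|[set i : 'I_n | joint_eig A U i == lam]| = m.

Definition joint_geo_mult A lam : nat :=
  \rank (\bigcap_(k < d) rker (A k - (lam 0 k)%:M))%MS.

Definition semisimple_joint_eigenvalue A lam (p : nat) : Prop :=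
  [/\ (0 < p)%N, joint_alg_mult A lam p & joint_geo_mult A lam = p].

Definition lincomb mu A : 'M[R[i]]_n := \sum_(k < d) mu 0 k *: A k.

Definition lineval mu lam : R[i] := \sum_(k < d) mu 0 k * lam 0 k.

Definition perturb A (E : 'I_d -> 'M[R[i]]_n) (e : R) : 'I_d -> 'M[R[i]]_n :=
  fun k => A k + e%:C *: E k.

Definition rayleigh A (x : 'cV[R[i]]_n) : 'rV[R[i]]_d :=
  \row_k (x ^t* *m A k *m x) 0 0.

End CommutingFamilies.

Section ClosestEigenvalues.
Context (R : realType) (n p : nat).
Implicit Types (M : 'M[R[i]]_n) (c : R[i]) (theta : 'rV[R[i]]_p).

(* theta lists, with algebraic multiplicity, p eigenvalues of M that are
   closest to c; in case of a tie any choice is allowed. *)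
Definition closest_eigenvalues M c theta : Prop :=
  exists2 s : seq R[i],
    char_poly M =
      \prod_(i < p) ('X - (theta 0 i)%:P) * \prod_(z <- s) ('X - z%:P) &
    forall i z, z \in s -> `|theta 0 i - c| <= `|z - c|.

Definition closest_semisimple M c theta : Prop :=
  closest_eigenvalues M c theta /\
  forall i, semisimple_eigenvalue M (theta 0 i).

(* The columns of Xt and Yt are right and left eigenvectors for theta. *)
Definition normalized_eigenvectors M theta (Xt Yt : 'M[R[i]]_(n, p)) : Prop :=
  [/\ M *m Xt = Xt *m diag_mx theta,
      Yt ^t* *m M = diag_mx theta *m Yt ^t*,
      Yt ^t* *m Xt = 1%:M &
      forall i, frob (col i Xt) = 1].

End ClosestEigenvalues.

(* The Borel sigma-algebra of C^d = R^(2d), generated by the real and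
   imaginary parts of the coordinates. *)
Definition Cvec (R : realType) (d : nat) : Type := 'rV[R[i]]_d.

HB.instance Definition _ (R : realType) (d : nat) :=
  Choice.on (Cvec R d).
HB.instance Definition _ (R : realType) (d : nat) :=
  isPointed.Build (Cvec R d) (0 : 'rV[R[i]]_d).

Definition coordinate_sets (R : realType) (d : nat) : set (set (Cvec R d)) :=
  [set A | exists (k : 'I_d) (B : set R), measurable B /\
     (A = [set x : 'rV[R[i]]_d | B (complex.Re (x 0 k))] \/
      A = [set x : 'rV[R[i]]_d | B (complex.Im (x 0 k))])].

Notation borelCvec R d := (g_sigma_algebraType (@coordinate_sets R d)).

(* The uniform distribution on the unit sphere of C^d is the unique Borel
   probability measure carried by the sphere and invariant under the unitary
   group. *)
Definition uniform_on_sphere (R : realType) (d : nat)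
    (P : probability (borelCvec R d) R) : Prop :=
  P [set x : 'rV[R[i]]_d | frob x = 1] = 1%E /\
  forall (U : 'M[R[i]]_d) (A : set (borelCvec R d)), U \is unitarymx ->
    measurable A -> P [set x : 'rV[R[i]]_d | A (x *m U)] = P A.

(* Main.v *)
Require Import Defs.
From HB Require Import structures.
From mathcomp Require Import all_boot all_order all_algebra.
From mathcomp Require Import sesquilinear spectral cyclic separable cyclotomic.
From mathcomp Require Import all_classical all_reals all_analysis.
From mathcomp Require Import measurable_realfun complex.
From mathcomp Require Import ring lra.

Set Implicit Arguments.
Unset Strict Implicit.
Unset Printing Implicit Defensive.

Import Order.TTheory GRing.Theory Num.Theory.
Import numFieldNormedType.Exports.

Local Open Scope classical_set_scope.
Local Open Scope ring_scope.
Local Open Scope complex_scope.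
Local Open Scope sesquilinear_scope.

(** The deterministic part. Let [x] be a unit eigenvector of the perturbed
    combination for an eigenvalue [theta] among the closest ones, and let
    [gap_j] in C^d be the [j]-th remaining joint eigenvalue minus [lam]. In the
    bases [X], [Y] the error of the Rayleigh quotients splits into
    [e * (x^* E_k x)_k], of norm at most [e], and
    [(x^* (A_k - lam_k) x)_k = sum_j conj(h_j) b_j gap_j] with [h = X2^* x] and
    [b = Y2^* x] ([rayleigh_sub_eig_gap]). Multiplying the eigenvector equation
    by [Y2^*] gives [(theta - a_j) b_j = e g_j], where [a_j] is the [j]-th
    diagonal entry of [sum_k mu_k A22_k] and [g = Y2^* (sum_k mu_k E_k) x]
    ([eigenvector_component]). Hence the second part is at most
    [|X2| |Y2| r e] as soon as [|gap_j| <= r |theta - a_j|] for all [j]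
    ([frob_rayleigh_sub_le]); vanishing gaps contribute nothing. Now
    [a_j - lam(mu)] is the linear form [sum_k mu_k gap_jk], and [theta] tends
    to [lam(mu)] with [e], by an elementary root continuity argument
    ([closest_eigenvalues_near]). So if [|gap_j| / r < |sum_k mu_k gap_jk|]
    for every nonzero gap, a strict inequality that small changes of
    [theta] preserve, the bound holds for all small [e] without quadratic term,
    and for the other [e] the term [C e^2] absorbs the second part
    ([rayleigh_error_bound]).

    The probabilistic part. It remains to show that, for a fixed [v != 0], the
    event [|sum_k mu_k v_k| <= |v| / r] has probability at most
    [d (d - 1) / r^2], and to sum over the at most [q] gaps. The law
    enters only through its unitary invariance and its being carried by the
    sphere. Invariance reduces the linear form to one coordinate [x_i] ([prob_small_linear_form]). For a second coordinate
    [x_j], the ratio [V = |x_i|^2 / (|x_i|^2 + |x_j|^2)] behaves as a uniform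
    variable: rotating in the plane of the two coordinates by infinitely many
    angles and averaging over relative phases taken among the roots of unity
    shows that all Bernstein polynomials of degree [k] in [V] have the same
    expectation, at most [1 / (k + 1)] ([expect_bernstein_le]), and Chebyshev's
    inequality turns this into [P (V <= v) <= v] ([prob_pair_ratio_le]). Finally a
    point of the sphere with [|x_i|^2 <= s] has a coordinate [x_j] of at least
    average size, for which [V <= (d - 1) s]; summing over the [d - 1] indices
    [j] yields the probability bound [(d - 1)^2 s] ([prob_small_coord]), which
    is at most [d (d - 1) s]. *)

(** * Euclidean, Frobenius and spectral norms *)

Section Frobenius.
Context (R : realType).
Local Notation normc := ComplexField.Normc.normc.

Lemma conjCE (z : R[i]) : Num.conj z = conjc z.
Proof. by []. Qed.

Lemma normr_normc (z : R[i]) : `|z| = (normc z)%:C.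
Proof. by rewrite normc_def; case: z. Qed.

Lemma normc_ge0 (z : R[i]) : 0 <= normc z.
Proof. by case: z => a b; exact: sqrtr_ge0. Qed.

Lemma normc_conj (z : R[i]) : normc z^* = normc z.
Proof. by case: z => a b /=; rewrite sqrrN. Qed.

Lemma normc_real (a : R) : normc a%:C = `|a|.
Proof. by rewrite /= expr0n addr0 sqrtr_sqr. Qed.

Lemma normc_sum (I : finType) (f : I -> R[i]) :
  normc (\sum_i f i) <= \sum_i normc (f i).
Proof.
rewrite -lecR -normr_normc (rmorph_sum (real_complex R)).
exact: (le_trans (ler_norm_sum _ _ _)).
Qed.

(** Lagrange's identity: the difference of the two sides is half a sum of
    squares. *)
Lemma sum_cauchy_schwarz (I : finType) (a b : I -> R) :
  (\sum_i a i * b i) ^+ 2 <= (\sum_i a i ^+ 2) * (\sum_i b i ^+ 2).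
Proof.
have H : 0 <= \sum_i \sum_j (a i * b j - a j * b i) ^+ 2.
  by apply: sumr_ge0 => i _; apply: sumr_ge0 => j _; exact: sqr_ge0.
have E : \sum_i \sum_j (a i * b j - a j * b i) ^+ 2 =
   2 * ((\sum_i a i ^+ 2) * (\sum_i b i ^+ 2)) - 2 * (\sum_i a i * b i) ^+ 2.
  transitivity (\sum_i \sum_j (a i ^+ 2 * b j ^+ 2) +
     (\sum_i \sum_j (b i ^+ 2 * a j ^+ 2) -
       2 * \sum_i \sum_j ((a i * b i) * (a j * b j)))).
    rewrite mulr_sumr -sumrB -big_split; apply: eq_bigr => i _.
    rewrite mulr_sumr -sumrB -big_split; apply: eq_bigr => j _ /=; ring.
  rewrite -!big_distrlr /=; ring.
rewrite E in H; lra.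
Qed.

Lemma sum_cauchy_schwarz_sqrt (I : finType) (a b : I -> R) :
  \sum_i a i * b i <=
  Num.sqrt (\sum_i a i ^+ 2) * Num.sqrt (\sum_i b i ^+ 2).
Proof.
rewrite -sqrtrM ?sumr_ge0// => [|i _]; last exact: sqr_ge0.
by rewrite (le_trans (ler_norm _))// -sqrtr_sqr ler_wsqrtr// sum_cauchy_schwarz.
Qed.

Section Rectangular.
Context (m n : nat).
Implicit Types M N : 'M[R[i]]_(m, n).

Lemma frob_ge0 M : 0 <= frob M. Proof. exact: sqrtr_ge0. Qed.

Lemma sqr_frob M : frob M ^+ 2 = \sum_i \sum_j normc (M i j) ^+ 2.
Proof.
by rewrite sqr_sqrtr// sumr_ge0// => i _; rewrite sumr_ge0// => j _; apply: sqr_ge0.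
Qed.

Lemma frob0 : frob (0 : 'M[R[i]]_(m, n)) = 0.
Proof.
rewrite /frob big1 ?sqrtr0// => i _; rewrite big1// => j _.
by rewrite mxE ComplexField.Normc.normc0 expr0n.
Qed.

Lemma frobZ a M : frob (a *: M) = normc a * frob M.
Proof.
rewrite /frob -[X in X * _](ger0_norm (normc_ge0 a)) -sqrtr_sqr -sqrtrM ?sqr_ge0//.
congr Num.sqrt; rewrite mulr_sumr; apply: eq_bigr => i _.
by rewrite mulr_sumr; apply: eq_bigr => j _; rewrite mxE ComplexField.Normc.normcM exprMn.
Qed.

Lemma ler_frobD M N : frob (M + N) <= frob M + frob N.
Proof.
rewrite -(@ler_pXn2r _ 2) ?nnegrE ?addr_ge0 ?frob_ge0//.
rewrite sqrrD !sqr_frob.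
have -> : frob M * frob N *+ 2 = 2 * (frob M * frob N) by rewrite mulr_natl.
set S1 := \sum_i _; set S2 := \sum_i _; set S3 := \sum_i _.
have CS : \sum_i \sum_j normc (M i j) * normc (N i j) <= frob M * frob N.
  rewrite /frob !pair_big.
  exact: (sum_cauchy_schwarz_sqrt (fun k => normc (M k.1 k.2))).
have : S1 <= S2 + S3 + 2 * (\sum_i \sum_j normc (M i j) * normc (N i j)).
  rewrite mulr_sumr -!big_split; apply: ler_sum => i _.
  rewrite mulr_sumr -!big_split; apply: ler_sum => j _ /=.
  have -> : normc (M i j) ^+ 2 + normc (N i j) ^+ 2 +
     2 * (normc (M i j) * normc (N i j)) = (normc (M i j) + normc (N i j)) ^+ 2.
    by ring.
  by rewrite lerXn2r ?nnegrE ?addr_ge0 ?normc_ge0// mxE le_normcD.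
move=> H; lra.
Qed.

Lemma ler_frob_sum (I : finType) (F : I -> 'M[R[i]]_(m, n)) :
  frob (\sum_i F i) <= \sum_i frob (F i).
Proof.
elim/big_ind2 : _ => [|x y u v|//]; first by rewrite frob0.
by move=> h1 h2; rewrite (le_trans (ler_frobD _ _))// lerD.
Qed.

Lemma normc_le_frob M i j : normc (M i j) <= frob M.
Proof.
rewrite -[leLHS](ger0_norm (normc_ge0 _)) -sqrtr_sqr ler_wsqrtr//.
rewrite (bigD1 i)//= (bigD1 j)//= -addrA lerDl addr_ge0 ?sumr_ge0//.
- by move=> k _; exact: sqr_ge0.
- by move=> k _; rewrite sumr_ge0// => l _; exact: sqr_ge0.
Qed.

Lemma frob_ctr M : frob (M ^t*) = frob M.
Proof.
rewrite /frob exchange_big /=; congr Num.sqrt; apply: eq_bigr => i _.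
by apply: eq_bigr => j _; rewrite !mxE normc_conj.
Qed.

End Rectangular.

Lemma ler_frobM (m n l : nat) (M : 'M[R[i]]_(m, n)) (N : 'M[R[i]]_(n, l)) :
  frob (M *m N) <= frob M * frob N.
Proof.
rewrite -(@ler_pXn2r _ 2) ?nnegrE ?mulr_ge0 ?frob_ge0//.
rewrite exprMn !sqr_frob [X in _ <= _ * X]exchange_big /=.
rewrite big_distrlr /=; apply: ler_sum => i _; apply: ler_sum => j _.
rewrite mxE; apply: le_trans (sum_cauchy_schwarz _ _).
rewrite lerXn2r ?nnegrE ?normc_ge0 ?sumr_ge0//.
  by move=> k _; rewrite mulr_ge0 ?normc_ge0.
rewrite (le_trans (normc_sum _))//; apply: ler_sum => k _.
by rewrite ComplexField.Normc.normcM.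
Qed.

Lemma frob_mx11 (M : 'M[R[i]]_1) : frob M = normc (M 0 0).
Proof. by rewrite /frob !big_ord1 sqrtr_sqr ger0_norm ?normc_ge0. Qed.

Lemma sqr_frob_col (n : nat) (v : 'cV[R[i]]_n) :
  (frob v ^+ 2)%:C = (v ^t* *m v) 0 0.
Proof.
rewrite sqr_frob mxE rmorph_sum; apply: eq_bigr => i _ /=.
by rewrite big_ord1 !mxE conjCE mulrC -sqr_normc normr_normc rmorphXn.
Qed.

(** The supremum defining the spectral norm is finite because the Frobenius norm
    is submultiplicative. *)
Lemma specnorm_has_sup (m n : nat) (M : 'M[R[i]]_(m, n)) :
  has_sup [set frob (M *m v) | v in [set v : 'cV[R[i]]_n | frob v <= 1]].
Proof.
split; first by exists (frob (M *m (0 : 'cV_n))), 0 => //=; rewrite frob0.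
exists (frob M) => _ /= [v v1 <-]; apply: le_trans (ler_frobM _ _) _.
by rewrite ler_piMr ?frob_ge0.
Qed.

Lemma specnorm_ge0 (m n : nat) (M : 'M[R[i]]_(m, n)) : 0 <= specnorm M.
Proof.
apply: le_trans (frob_ge0 (M *m (0 : 'cV_n))) _.
by apply: (ub_le_sup (proj2 (specnorm_has_sup M))); exists 0 => //=; rewrite frob0.
Qed.

Lemma frob_eq0 (m n : nat) (M : 'M[R[i]]_(m, n)) : frob M = 0 -> M = 0.
Proof.
move=> M0; apply/matrixP => i j; rewrite mxE.
apply: ComplexField.Normc.eq0_normc; apply/eqP.
by rewrite eq_le normc_ge0 andbT -M0 normc_le_frob.
Qed.

Lemma frob_mulmx_specnorm (m n : nat) (M : 'M[R[i]]_(m, n)) (v : 'cV[R[i]]_n) :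
  frob (M *m v) <= specnorm M * frob v.
Proof.
have [/frob_eq0 ->|v0] := eqVneq (frob v) 0.
  by rewrite mulmx0 !frob0 mulr0.
have vp : 0 < frob v by rewrite lt_neqAle eq_sym v0 frob_ge0.
rewrite -ler_pdivrMr//.
apply: (ub_le_sup (proj2 (specnorm_has_sup M))).
have nv : normc ((frob v)^-1)%:C = (frob v)^-1.
  by rewrite normc_real ger0_norm// invr_ge0 frob_ge0.
exists (((frob v)^-1)%:C *: v) => /=.
  by rewrite frobZ nv mulVf.
by rewrite -scalemxAr frobZ nv mulrC.
Qed.

(** A matrix and its adjoint have the same spectral norm: [|M^* z|^2] is the
    inner product of [z] with [M (M^* z)]. *)
Lemma frob_ctr_mulmx_specnorm (m n : nat) (M : 'M[R[i]]_(m, n)) (z : 'cV[R[i]]_m) :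
  frob (M ^t* *m z) <= specnorm M * frob z.
Proof.
set w := M ^t* *m z.
have [->|w0] := eqVneq (frob w) 0; first by rewrite mulr_ge0 ?specnorm_ge0 ?frob_ge0.
have wp : 0 < frob w by rewrite lt_neqAle eq_sym w0 frob_ge0.
rewrite -(ler_pM2r wp) -expr2.
have -> : frob w ^+ 2 = normc ((w ^t* *m w) 0 0).
  by rewrite -sqr_frob_col normc_real ger0_norm ?sqr_ge0.
rewrite -frob_mx11.
have -> : w ^t* *m w = z ^t* *m (M *m w).
  by rewrite {1}/w trmx_mul map_mxM trmxCK -mulmxA.
apply: le_trans (ler_frobM _ _) _.
rewrite frob_ctr mulrC mulrAC ler_wpM2r ?frob_ge0//.
exact: frob_mulmx_specnorm.
Qed.

End Frobenius.

(** * Continuity of the eigenvalues closest to a multiple eigenvalue *)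

Section RootContinuity.

(** The coefficients of a quotient by [X - z] are found from the constant term
    upwards, each step dividing by [z]; when [z] stays away from 0, the low
    coefficients of the quotient are controlled by those of the product. *)
Lemma coef_mul_XsubC_bound (K : numFieldType) (p : nat) (eta eps z : K)
    (g : {poly K}) :
  0 < eta -> 0 <= eps -> eta <= `|z| ->
  (forall k, (k < p)%N -> `|(g * ('X - z%:P))`_k| <= eps) ->
  forall k, (k < p)%N -> `|g`_k| <= eps * (1 + 2 / eta) ^+ p.
Proof.
move=> eta0 eps0 etaz fk.
set L := 1 + 2 / eta.
have L1 : 1 <= L by rewrite lerDl divr_ge0// ltW.
have L0 : 0 <= L by rewrite (le_trans ler01).
suff H k : (k < p)%N -> `|g`_k| <= eps * L ^+ k.+1.
  move=> k kp; apply: le_trans (H k kp) _.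
  by rewrite ler_wpM2l// ler_weXn2l.
(* [x] stands for the previous coefficient of [g], which is 0 when [j = 0] *)
have step j (x : K) : `|x| <= eps * L ^+ j -> `|g`_j * z| <= eps + `|x| ->
    `|g`_j| <= eps * L ^+ j.+1.
  move=> hx; rewrite normrM => hg.
  have h1 : `|g`_j| * eta <= eps + eps * L ^+ j.
    apply: le_trans (_ : `|g`_j| * `|z| <= _); first by rewrite ler_wpM2l.
    by apply: le_trans hg _; rewrite lerD2l.
  have h2 : eps + eps * L ^+ j <= 2 * (eps * L ^+ j).
    rewrite mulr_natl mulr2n lerD2r -[leLHS]mulr1 ler_wpM2l//.
    by rewrite exprn_ege1.
  rewrite -(ler_pM2r eta0); apply: le_trans h1 _; apply: le_trans h2 _.
  have Leta : L * eta = eta + 2 by rewrite /L mulrDl mul1r divfK ?gt_eqF.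
  have -> : eps * L ^+ j.+1 * eta = (eta + 2) * (eps * L ^+ j).
    by rewrite -Leta exprSr; ring.
  by rewrite ler_wpM2r ?mulr_ge0 ?exprn_ge0// lerDr ltW.
elim: k => [|k IH] kp.
  apply: (step 0%N 0); rewrite ?normr0 ?mulr_ge0 ?exprn_ge0// addr0.
  have := fk 0%N kp; rewrite mulrBr coefB coefMX coefMC /= sub0r normrN.
  by [].
apply: (step k.+1 g`_k); first by apply: IH; exact: ltnW.
have := fk k.+1 kp; rewrite mulrBr coefB coefMX coefMC /= => h.
rewrite -[_ * z](subKr g`_k) [eps + _]addrC.
by apply: le_trans (ler_normB _ _) _; rewrite lerD2l.
Qed.

Lemma coef_mul_prod_XsubC_bound (K : numFieldType) (p : nat) (eta : K) (s : seq K)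
    (g : {poly K}) (eps : K) :
  0 < eta -> 0 <= eps -> (forall z, z \in s -> eta <= `|z|) ->
  (forall k, (k < p)%N -> `|(g * \prod_(z <- s) ('X - z%:P))`_k| <= eps) ->
  forall k, (k < p)%N -> `|g`_k| <= eps * ((1 + 2 / eta) ^+ p) ^+ size s.
Proof.
move=> eta0; have L0 : 0 <= 1 + 2 / eta by rewrite addr_ge0 ?divr_ge0// ltW.
elim: s g eps => [|z s IH] g eps eps0 hs hf.
  by move=> k kp; rewrite /= expr0 mulr1; move: (hf k kp); rewrite big_nil mulr1.
have hz : eta <= `|z| by apply: hs; rewrite mem_head.
have H1 k : (k < p)%N -> `|(g * ('X - z%:P))`_k| <=
    eps * ((1 + 2 / eta) ^+ p) ^+ size s.
  apply: IH => // [w ws|j jp]; first by apply: hs; rewrite in_cons ws orbT.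
  by have := hf j jp; rewrite big_cons mulrA.
move=> k kp; rewrite /= exprSr mulrA.
by apply: (coef_mul_XsubC_bound eta0 _ hz H1); rewrite // mulr_ge0 ?exprn_ge0.
Qed.

(** A family of polynomials depending polynomially on a parameter [e] is encoded
    as a polynomial with polynomial coefficients, evaluated at the constant
    [e]. *)
Lemma horner_coef_bounded (K : numDomainType) (D : {poly {poly K}}) (k : nat) :
  exists B : K, 0 <= B /\
    forall e : K, 0 <= e <= 1 -> `|(D.[e%:P])`_k| <= B.
Proof.
elim/poly_ind : D => [|D c [B [B0 hB]]].
  by exists 0; split=> // e _; rewrite horner0 coef0 normr0.
exists (B + `|c`_k|); split=> [|e /andP[e0 e1]]; first by rewrite addr_ge0.
rewrite hornerMXaddC coefD coefMC (le_trans (ler_normD _ _))// lerD2r normrM.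
by rewrite -[leRHS]mulr1 ler_pM// ?(ger0_norm e0)// hB// e0 e1.
Qed.

Lemma horner_coef_lipschitz0 (K : numDomainType) (D : {poly {poly K}}) (k : nat) :
  exists B : K, 0 <= B /\
    forall e : K, 0 <= e <= 1 -> `|(D.[e%:P])`_k - (D.[0])`_k| <= e * B.
Proof.
elim/poly_ind : D => [|D c _].
  by exists 0; split=> // e _; rewrite !horner0 subrr normr0 mulr0.
have [B [B0 hB]] := horner_coef_bounded D k.
exists B; split=> // e he; have /andP[e0 e1] := he.
rewrite !hornerMXaddC mulr0 add0r coefD addrK coefMC normrM mulrC ger0_norm//.
by rewrite ler_wpM2l// hB.
Qed.

Lemma det_coef_lipschitz0 (K : numDomainType) (n k : nat) (M N : 'M[{poly K}]_n) :
  exists B : K, 0 <= B /\ forall e : K, 0 <= e <= 1 ->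
    `|(\det (M + e%:P *: N))`_k - (\det M)`_k| <= e * B.
Proof.
pose D := \det (map_mx polyC M + 'X *: map_mx polyC N).
have DE x : D.[x] = \det (M + x *: N).
  rewrite /D -horner_evalE -det_map_mx; congr (\det _).
  apply/matrixP => i j; rewrite !mxE /= /horner_eval.
  by rewrite hornerD hornerM hornerX !hornerC.
have [B [B0 hB]] := horner_coef_lipschitz0 D k.
exists B; split=> // e he.
by have := hB e he; rewrite !DE scale0r addr0.
Qed.

Lemma char_poly_shift (K : comNzRingType) (n : nat) (M : 'M[K]_n) (c : K) :
  char_poly (M - c%:M) = char_poly M \Po ('X + c%:P).
Proof.
rewrite /char_poly -[RHS]/(comp_poly _ _) -det_map_mx; congr (\det _).
apply/matrixP => i j; rewrite !mxE /= comp_polyB comp_polyC polyCB.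
case: (i == j); rewrite ?mulr1n ?mulr0n ?comp_polyX ?comp_polyC ?polyC0.
  by rewrite opprB addrA addrAC.
by rewrite subr0.
Qed.

Lemma char_poly_perturb (K : numFieldType) (n p : nat) (M N : 'M[K]_n) :
  (forall k, (k < p)%N -> (char_poly M)`_k = 0) ->
  exists B : K, 0 <= B /\ forall e : K, 0 <= e <= 1 ->
    forall k, (k < p)%N -> `|(char_poly (M + e *: N))`_k| <= e * B.
Proof.
move=> M0.
have /choice[B hB] k := det_coef_lipschitz0 k (char_poly_mx M) (- map_mx polyC N).
exists (\sum_(k < p) B k); split=> [|e he k kp].
  by apply: sumr_ge0 => k _; case: (hB k).
have [Bk0 /(_ e he)] := hB k.
rewrite -[\det (char_poly_mx M)]/(char_poly M) M0// subr0 => H.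
have -> : char_poly (M + e *: N) =
    \det (char_poly_mx M + e%:P *: - map_mx polyC N).
  congr (\det _); rewrite /char_poly_mx map_mxD map_mxZ scalerN -addrA.
  by rewrite -opprD.
apply: le_trans H _; have /andP[e0 _] := he.
rewrite ler_wpM2l// (bigD1 (Ordinal kp))//= lerDl sumr_ge0// => j _.
by case: (hB j).
Qed.

Lemma size_prod_XsubC_row (K : idomainType) (p : nat) (theta : 'rV[K]_p) (s : seq K) :
  size (\prod_(i < p) ('X - (theta 0 i)%:P) * \prod_(z <- s) ('X - z%:P)) =
  (p + size s).+1.
Proof.
have -> : \prod_(j < p) ('X - (theta 0 j)%:P) =
    \prod_(z <- [seq theta 0 j | j <- enum 'I_p]) ('X - z%:P).
  by rewrite big_map big_enum.
by rewrite -big_cat size_prod_XsubC size_cat size_map size_enum_ord.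
Qed.

Lemma comp_prod_XsubC_row (K : idomainType) (p : nat) (theta : 'rV[K]_p) (s : seq K)
    (c : K) (i : 'I_p) :
  (\prod_(j < p) ('X - (theta 0 j)%:P) * \prod_(z <- s) ('X - z%:P)) \Po ('X + c%:P) =
  (\prod_(j < p | j != i) ('X - (theta 0 j - c)%:P)) *
    \prod_(z <- (theta 0 i - c) :: [seq z - c | z <- s]) ('X - z%:P).
Proof.
have XE z : ('X - z%:P) \Po ('X + c%:P) = 'X - (z - c)%:P.
  by rewrite comp_polyB comp_polyX comp_polyC polyCB opprB addrA addrAC.
rewrite comp_polyM !rmorph_prod /= big_cons big_map mulrA; congr (_ * _).
  rewrite (bigD1 i)//= XE mulrC; congr (_ * _).
  by apply: eq_bigr => j _; rewrite XE.
by apply: eq_bigr => z _; rewrite XE.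
Qed.

(** Continuity of the roots near a root [c] of multiplicity at least [p]. After
    shifting [c] to the origin, the coefficients of degree below [p] of the
    characteristic polynomial are [O(e)]. If one of the [p] closest roots stayed
    away from the origin, so would all the roots outside the list; dividing
    these roots out keeps the low coefficients [O(e)] and leaves a monic
    polynomial of degree [p - 1], whose leading coefficient is 1. *)
Lemma closest_eigenvalues_near (R : realType) (n p : nat) (M N : 'M[R[i]]_n)
    (c : R[i]) (eta : R) :
  (forall k, (k < p)%N -> (char_poly (M - c%:M))`_k = 0) -> 0 < eta ->
  exists2 e0 : R, 0 < e0 & forall e, 0 < e -> e < e0 ->
    forall theta : 'rV[R[i]]_p,
      closest_eigenvalues (M + e%:C *: N) c theta ->
      forall i, ComplexField.Normc.normc (theta 0 i - c) <= eta.
Proof.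
move=> M0 eta0; have [B [B0 hB]] := char_poly_perturb N M0.
have etaC0 : 0 < eta%:C by rewrite ltcR.
(* [e * kap] bounds the coefficients left after dividing [(n - p).+1] roots
   out: the [n - p] unlisted ones and a listed one far from [c] *)
pose kap : R[i] := B * ((1 + 2 / eta%:C) ^+ p) ^+ (n - p).+1.
have kap0 : 0 <= kap by rewrite mulr_ge0// !exprn_ge0// addr_ge0// divr_ge0// ltW.
have /complex_realP[kr krE] : kap \is Num.real by rewrite ger0_real.
have kr0 : 0 <= kr by rewrite -ler0c -krE.
exists (Num.min 1 (kr + 1)^-1).
  by rewrite lt_min ltr01 invr_gt0 ltr_wpDl.
move=> e ep; rewrite lt_min => /andP[e1 ek] theta [s sE hs] i.
rewrite leNgt; apply/negP => far.
have ek1 : e * kr < 1.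
  have k1 : 0 < kr + 1 by rewrite ltr_wpDl.
  have : e * (kr + 1) < 1 by rewrite -ltr_pdivlMr// mul1r.
  by apply: le_lt_trans; rewrite ler_wpM2l ?(ltW ep)// lerDl.
have eC : 0 <= e%:C <= 1 by rewrite ler0c (ltW ep) lecR ltW.
have farC : eta%:C <= `|theta 0 i - c| by rewrite normr_normc lecR ltW.
pose g : {poly R[i]} := \prod_(j < p | j != i) ('X - (theta 0 j - c)%:P).
pose t := (theta 0 i - c) :: [seq z - c | z <- s].
have szs : (p + size s = n)%N.
  apply/succn_inj; rewrite -(size_char_poly (M + e%:C *: N)) sE.
  by rewrite size_prod_XsubC_row.
have fE : char_poly (M - c%:M + e%:C *: N) = g * \prod_(z <- t) ('X - z%:P).
  by rewrite addrAC char_poly_shift sE (comp_prod_XsubC_row _ _ _ i).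
have gm : g \is monic by apply: monic_prod => j _; exact: monicXsubC.
have p0 : (0 < p)%N by exact: leq_ltn_trans (ltn_ord i).
have gs : size g = p.
  have -> : g = \prod_(z <- [seq theta 0 j - c | j <- enum (predC1 i)]) ('X - z%:P).
    by rewrite big_map big_enum.
  by rewrite size_prod_XsubC size_map -cardE cardC1 card_ord prednK.
(* [g] collects the other listed roots: its leading coefficient has index below
   [p] and is 1, hence too large *)
have gp : g`_p.-1 = 1 by move/monicP : gm; rewrite lead_coefE gs.
have := @coef_mul_prod_XsubC_bound _ p eta%:C t g (e%:C * B) etaC0.
rewrite -fE => /(_ _ _ _ p.-1); rewrite gp normr1 prednK// leqnn.
have -> : e%:C * B * ((1 + 2 / eta%:C) ^+ p) ^+ size t = e%:C * kap.
  rewrite /kap mulrA /t /= size_map; congr (_ * _ ^+ _.+1).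
  by rewrite -szs addKn.
rewrite krE -(rmorphM (real_complex R)) lecR leNgt ek1 /= => H.
apply: notF; apply: H => //.
- by rewrite mulr_ge0//; case/andP : eC.
- move=> z; rewrite in_cons => /predU1P[->//|/mapP[w ws ->]].
  by apply: le_trans farC _; exact: hs.
- by move=> k kp; exact: hB.
Qed.

End RootContinuity.

(** * The deterministic error bound *)

Section BlockDiagonalization.
Context (R : realType) (p q : nat).
Context (X1 Y1 : 'M[R[i]]_(p + q, p)) (X2 Y2 : 'M[R[i]]_(p + q, q)).
Context (hYX : (row_mx Y1 Y2) ^t* *m row_mx X1 X2 = 1%:M).
Context (M : 'M[R[i]]_(p + q)) (l : R[i]) (D : 'M[R[i]]_q).
Context (hM : (row_mx Y1 Y2) ^t* *m M *m row_mx X1 X2 = block_mx l%:M 0 0 D).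

Lemma ctr_row_mx : (row_mx Y1 Y2) ^t* = col_mx (Y1 ^t*) (Y2 ^t*).
Proof. by rewrite tr_row_mx map_col_mx. Qed.

Lemma mulmx_dual_basis : row_mx X1 X2 *m (row_mx Y1 Y2) ^t* = 1%:M.
Proof. exact: mulmx1C hYX. Qed.

Lemma block_left_invariant : Y2 ^t* *m M = D *m Y2 ^t*.
Proof.
have H : (row_mx Y1 Y2) ^t* *m M = block_mx l%:M 0 0 D *m (row_mx Y1 Y2) ^t*.
  by rewrite -hM -!mulmxA mulmx_dual_basis mulmx1.
move: H; rewrite ctr_row_mx mul_col_mx mul_block_col => /eq_col_mx[_].
by rewrite mul0mx add0r.
Qed.

(** [l] being the eigenvalue of the first block, subtracting it kills the
    contribution of [X1] and [Y1]. *)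
Lemma block_shift : M - l%:M = X2 *m (D - l%:M) *m Y2 ^t*.
Proof.
have H : M - l%:M =
    row_mx X1 X2 *m (block_mx l%:M 0 0 D - l%:M) *m (row_mx Y1 Y2) ^t*.
  rewrite mulmxBr mulmxBl -hM; congr (_ - _).
    by rewrite !mulmxA mulmx_dual_basis mul1mx -mulmxA mulmx_dual_basis mulmx1.
  by rewrite mul_mx_scalar -scalemxAl mulmx_dual_basis scalemx1.
rewrite H scalar_mx_block opp_block_mx add_block_mx !oppr0 !addr0 subrr.
rewrite ctr_row_mx mul_row_block mul_row_col !mulmx0 !add0r mul0mx.
by rewrite add0r.
Qed.

(** [l] is an eigenvalue of multiplicity at least [p], so that [X^p] divides the
    shifted characteristic polynomial. *)
Lemma char_poly_block_shift k : (k < p)%N -> (char_poly (M - l%:M))`_k = 0.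
Proof.
move=> kp.
have simE (N : 'M[R[i]]_(p + q)) :
    char_poly ((row_mx Y1 Y2) ^t* *m N *m row_mx X1 X2) = char_poly N.
  have : map_mx polyC ((row_mx Y1 Y2) ^t*) *m map_mx polyC (row_mx X1 X2) = 1%:M.
    by rewrite -map_mxM hYX map_mx1.
  move=> PQ; rewrite /char_poly.
  have -> : char_poly_mx ((row_mx Y1 Y2) ^t* *m N *m row_mx X1 X2) =
      map_mx polyC ((row_mx Y1 Y2) ^t*) *m char_poly_mx N *m
        map_mx polyC (row_mx X1 X2).
    rewrite /char_poly_mx mulmxBr mulmxBl !map_mxM; congr (_ - _).
    by rewrite mul_mx_scalar -scalemxAl PQ scalemx1.
  rewrite !det_mulmx mulrAC -det_mulmx PQ det1 mul1r //.
rewrite -simE.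
have -> : (row_mx Y1 Y2) ^t* *m (M - l%:M) *m row_mx X1 X2 =
    block_mx 0 0 0 (D - l%:M).
  rewrite mulmxBr mulmxBl hM mul_mx_scalar -scalemxAl hYX scalemx1.
  by rewrite scalar_mx_block opp_block_mx add_block_mx !oppr0 !addr0 subrr.
rewrite /char_poly char_block_diag_mx det_ublock.
have -> : \det (char_poly_mx (0 : 'M[R[i]]_p)) = 'X^p.
  by rewrite /char_poly_mx map_mx0 subr0 det_scalar.
by rewrite coefXnM kp.
Qed.

End BlockDiagonalization.

Section RayleighBounds.
Context (R : realType) (d n : nat).
Local Notation normc := ComplexField.Normc.normc.

Lemma lincomb_perturb (mu : 'rV[R[i]]_d) (A E : 'I_d -> 'M[R[i]]_n) e :
  lincomb mu (perturb A E e) = lincomb mu A + e%:C *: lincomb mu E.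
Proof.
rewrite /lincomb scaler_sumr -big_split; apply: eq_bigr => k _.
by rewrite scalerDr !scalerA mulrC.
Qed.

Lemma frob_lincomb_le (mu : 'rV[R[i]]_d) (E : 'I_d -> 'M[R[i]]_n) :
  frob (lincomb mu E) <= frob mu * Num.sqrt (\sum_k frob (E k) ^+ 2).
Proof.
apply: le_trans (ler_frob_sum _) _.
under eq_bigr do rewrite frobZ.
apply: le_trans (sum_cauchy_schwarz_sqrt _ _) _.
by rewrite {2}/frob big_ord1.
Qed.

Lemma frob_rayleigh_le (E : 'I_d -> 'M[R[i]]_n) (x : 'cV[R[i]]_n) : frob x = 1 ->
  frob (rayleigh E x) <= Num.sqrt (\sum_k frob (E k) ^+ 2).
Proof.
move=> x1; apply: ler_wsqrtr; rewrite big_ord1; apply: ler_sum => k _.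
rewrite mxE -frob_mx11 lerXn2r ?nnegrE ?frob_ge0//.
apply: le_trans (ler_frobM _ _) _; rewrite x1 mulr1.
by apply: le_trans (ler_frobM _ _) _; rewrite frob_ctr x1 mul1r.
Qed.

Lemma rayleigh_perturb_sub (A E : 'I_d -> 'M[R[i]]_n) (lam : 'rV[R[i]]_d) e
    (x : 'cV[R[i]]_n) : frob x = 1 ->
  rayleigh (perturb A E e) x - lam =
  rayleigh (fun k => A k - (lam 0 k)%:M) x + e%:C *: rayleigh E x.
Proof.
move=> x1; have xx : (x ^t* *m x) 0 0 = 1 by rewrite -sqr_frob_col x1 expr1n.
have rE (N : 'I_d -> 'M[R[i]]_n) k : rayleigh N x 0 k = (x ^t* *m N k *m x) 0 0.
  by rewrite mxE.
have E' k : x ^t* *m perturb A E e k *m x = x ^t* *m (A k - (lam 0 k)%:M) *m x +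
    (e%:C *: (x ^t* *m E k *m x) + lam 0 k *: (x ^t* *m x)).
  rewrite /perturb mulmxBr mulmxBl mulmxDr mulmxDl mul_mx_scalar -!scalemxAl.
  by rewrite -scalemxAr -scalemxAl [_ *: _ + _ *: _]addrC addrA subrK.
have dE (y z : 'rV[R[i]]_d) k : (y + z) 0 k = y 0 k + z 0 k by rewrite mxE.
apply/rowP => k; rewrite !dE rE E' rE.
have -> : (e%:C *: rayleigh E x) 0 k = e%:C * (x ^t* *m E k *m x) 0 0.
  by rewrite mxE rE.
move: xx; move: (x ^t* *m _ *m x) (x ^t* *m _ *m x) (x ^t* *m x) => y z w w1.
by rewrite !mxE w1; ring.
Qed.

End RayleighBounds.

Section DeterministicBound.
Context (R : realType) (d p q : nat).
Local Notation normc := ComplexField.Normc.normc.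
Context (A : 'I_d -> 'M[R[i]]_(p + q)) (lam : 'rV[R[i]]_d).
Context (X1 Y1 : 'M[R[i]]_(p + q, p)) (X2 Y2 : 'M[R[i]]_(p + q, q)).
Context (A22 : 'I_d -> 'M[R[i]]_q) (E : 'I_d -> 'M[R[i]]_(p + q)).
Context (hYX : (row_mx Y1 Y2) ^t* *m row_mx X1 X2 = 1%:M).
Context (hYAX : forall k : 'I_d, (row_mx Y1 Y2) ^t* *m A k *m row_mx X1 X2 =
  block_mx (lam 0 k)%:M 0 0 (A22 k)).
Context (hA22 : forall k : 'I_d, is_diag_mx (A22 k)).
Context (hE : \sum_(k < d) frob (E k) ^+ 2 = 1).

Definition eig_gap (j : 'I_q) : 'rV[R[i]]_d := \row_k (A22 k j j - lam 0 k).

Lemma lincomb_block (mu : 'rV[R[i]]_d) :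
  (row_mx Y1 Y2) ^t* *m lincomb mu A *m row_mx X1 X2 =
  block_mx (lineval mu lam)%:M 0 0 (lincomb mu A22).
Proof.
rewrite /lincomb mulmx_sumr mulmx_suml.
transitivity (\sum_k mu 0 k *: block_mx ((lam 0 k)%:M : 'M[R[i]]_p) 0 0 (A22 k)).
  by apply: eq_bigr => k _; rewrite -scalemxAr -scalemxAl hYAX.
apply: (big_ind3 (fun (x : 'M[R[i]]_(p + q)) (y : R[i]) (z : 'M[R[i]]_q) =>
    x = block_mx (y%:M : 'M[R[i]]_p) 0 0 z)) => //.
- by rewrite raddf0 block_mx0.
- move=> x1 y1 z1 x2 y2 z2 -> ->.
  by rewrite add_block_mx !addr0 raddfD.
- by move=> k _; rewrite scale_block_mx scale_scalar_mx !scaler0.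
Qed.

Lemma is_diag_lincomb (mu : 'rV[R[i]]_d) : is_diag_mx (lincomb mu A22).
Proof.
apply/is_diag_mxP => j l jl; rewrite summxE big1// => k _.
by rewrite mxE (is_diag_mxP (hA22 k)) ?mulr0.
Qed.

Lemma lineval_eig_gap (mu : 'rV[R[i]]_d) j :
  lineval mu (eig_gap j) = lincomb mu A22 j j - lineval mu lam.
Proof.
rewrite /lineval /lincomb summxE -sumrB; apply: eq_bigr => k _.
by rewrite !mxE mulrBr.
Qed.

Lemma diag_mulmx_col (D : 'M[R[i]]_q) (b : 'cV[R[i]]_q) j :
  is_diag_mx D -> (D *m b) j 0 = D j j * b j 0.
Proof.
move=> /is_diag_mxP hD; rewrite mxE (bigD1 j)//= big1 ?addr0// => l lj.
by rewrite hD ?mul0r// eq_sym.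
Qed.

(** The joint error is a combination of the gap vectors with coefficients common
    to all [k]; this is what lets one factor [|gap_j|] out of all [d]
    components. *)
Lemma rayleigh_sub_eig_gap (x : 'cV[R[i]]_(p + q)) :
  rayleigh (fun k => A k - (lam 0 k)%:M) x =
  \sum_j (Num.conj ((X2 ^t* *m x) j 0) * (Y2 ^t* *m x) j 0) *: eig_gap j.
Proof.
apply/rowP => k; rewrite mxE (block_shift hYX (hYAX k)) summxE.
have -> : x ^t* *m (X2 *m (A22 k - (lam 0 k)%:M) *m Y2 ^t*) *m x =
    (X2 ^t* *m x) ^t* *m ((A22 k - (lam 0 k)%:M) *m (Y2 ^t* *m x)).
  by rewrite trmx_mul map_mxM trmxCK !mulmxA.
rewrite mxE; apply: eq_bigr => j _; rewrite diag_mulmx_col; last first.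
  apply/is_diag_mxP => l m lm; rewrite !mxE (is_diag_mxP (hA22 k))//.
  rewrite (_ : (l == m) = false).
    by rewrite mulr0n subrr.
  by apply/negbTE; move: lm; rewrite -val_eqE.
move: (X2 ^t* *m x) (Y2 ^t* *m x) => h b.
by rewrite !mxE eqxx mulr1n; ring.
Qed.

Section FixedPerturbation.
Context (mu : 'rV[R[i]]_d) (mu1 : frob mu = 1).

(** The eigenvector equation multiplied by [Y2^*], whose rows are left
    eigenvectors of the unperturbed combination. *)
Lemma eigenvector_component (e : R) (th : R[i]) (x : 'cV[R[i]]_(p + q)) j :
  lincomb mu (perturb A E e) *m x = th *: x ->
  (th - lincomb mu A22 j j) * (Y2 ^t* *m x) j 0 =
  e%:C * (Y2 ^t* *m (lincomb mu E *m x)) j 0.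
Proof.
move=> hx.
set b := Y2 ^t* *m x; set g := Y2 ^t* *m (lincomb mu E *m x).
have H : lincomb mu A22 *m b + e%:C *: g = th *: b.
  rewrite /b [RHS]scalemxAr -hx lincomb_perturb mulmxDl mulmxDr -scalemxAl -scalemxAr.
  by rewrite mulmxA -(block_left_invariant hYX (lincomb_block mu)) -mulmxA.
have : (lincomb mu A22 *m b + e%:C *: g) j 0 = (th *: b) j 0 by rewrite H.
rewrite mxE (diag_mulmx_col _ _ (is_diag_lincomb mu)).
move: b g {H} => b g; rewrite [X in _ + X = _]mxE [X in _ = X]mxE => H.
by rewrite mulrBl -H addrAC subrr add0r.
Qed.

(** The small denominator [th - a_j] is compensated by the gap it comes from,
    after which the Cauchy-Schwarz inequality for [h] and [g] leaves the two
    spectral norms. *)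
Lemma frob_rayleigh_sub_le (e r : R) (th : R[i]) (x : 'cV[R[i]]_(p + q)) :
  0 < e -> 0 <= r -> frob x = 1 ->
  lincomb mu (perturb A E e) *m x = th *: x ->
  (forall j, eig_gap j != 0 ->
     frob (eig_gap j) <= r * normc (th - lincomb mu A22 j j)) ->
  frob (rayleigh (fun k => A k - (lam 0 k)%:M) x)
    <= specnorm X2 * specnorm Y2 * r * e.
Proof.
move=> e0 r0 x1 hx hgap; rewrite rayleigh_sub_eig_gap.
set h := X2 ^t* *m x; set b := Y2 ^t* *m x.
pose g := Y2 ^t* *m (lincomb mu E *m x).
apply: le_trans (ler_frob_sum _) _.
apply: le_trans (_ : \sum_j r * e * (normc (h j 0) * normc (g j 0)) <= _).
  apply: ler_sum => j _.
  rewrite frobZ ComplexField.Normc.normcM conjCE normc_conj -mulrA [leRHS]mulrCA.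
  rewrite ler_wpM2l ?normc_ge0//.
  have [->|gap0] := eqVneq (eig_gap j) 0.
    by rewrite frob0 mulr0 !mulr_ge0 ?normc_ge0// ltW.
  apply: le_trans (_ : normc (b j 0) * (r * normc (th - lincomb mu A22 j j)) <= _).
    by rewrite ler_wpM2l ?normc_ge0// hgap.
  rewrite mulrCA -mulrA ler_wpM2l// mulrC -ComplexField.Normc.normcM.
  rewrite (eigenvector_component _ hx) ComplexField.Normc.normcM normc_real.
  by rewrite gtr0_norm.
rewrite -mulr_sumr.
have cs : \sum_j normc (h j 0) * normc (g j 0) <= frob h * frob g.
  have fE (v : 'cV[R[i]]_q) : frob v = Num.sqrt (\sum_j normc (v j 0) ^+ 2).
    by congr Num.sqrt; apply: eq_bigr => j _; rewrite big_ord1.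
  by rewrite !fE; exact: sum_cauchy_schwarz_sqrt.
have hh : frob h <= specnorm X2.
  by have := frob_ctr_mulmx_specnorm X2 x; rewrite x1 mulr1.
have hg : frob g <= specnorm Y2.
  apply: le_trans (frob_ctr_mulmx_specnorm _ _) _.
  rewrite -[leRHS]mulr1 ler_wpM2l ?specnorm_ge0//.
  apply: le_trans (ler_frobM _ _) _; rewrite x1 mulr1.
  by apply: le_trans (frob_lincomb_le _ _) _; rewrite mu1 hE sqrtr1 mulr1.
have hp : frob h * frob g <= specnorm X2 * specnorm Y2.
  by rewrite ler_pM ?frob_ge0.
rewrite -[_ * r * e]mulrA [leRHS]mulrC ler_wpM2l ?mulr_ge0 ?(ltW e0)//.
exact: le_trans cs hp.
Qed.

(** The hypothesis on the gaps is strict, so it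
    survives replacing [lineval mu lam] by a perturbed eigenvalue close to it:
    for small [e] the bound holds without quadratic term, and for the other [e]
    the quadratic term dominates a bound that does not depend on [e]. *)
Lemma rayleigh_error_bound (r : R) (i : 'I_p) : 0 < r ->
  (forall j, eig_gap j != 0 ->
     frob (eig_gap j) * r^-1 < normc (lineval mu (eig_gap j))) ->
  exists C : R, forall e : R, 0 < e ->
    forall (theta : 'rV[R[i]]_p) (Xt Yt : 'M[R[i]]_(p + q, p)),
      closest_semisimple (lincomb mu (perturb A E e)) (lineval mu lam) theta ->
      normalized_eigenvectors (lincomb mu (perturb A E e)) theta Xt Yt ->
      frob (rayleigh (perturb A E e) (col i Xt) - lam)
        <= (1 + specnorm X2 * specnorm Y2 * r) * e + C * e ^+ 2.
Proof.
move=> r0 hmu.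
(* [gapd j] is the room left by the strict inequality *)
pose gapd j := normc (lineval mu (eig_gap j)) - frob (eig_gap j) * r^-1.
pose eta := \big[Order.min/1]_(j | eig_gap j != 0) gapd j.
have eta0 : 0 < eta.
  by apply: lt_bigmin => // j gj; rewrite subr_gt0; exact: hmu.
have etaP j : eig_gap j != 0 -> eta <= gapd j.
  exact: (bigmin_le_cond _ gapd).
have [e0 e00 near] := closest_eigenvalues_near (lincomb mu E)
  (fun k => char_poly_block_shift hYX (lincomb_block mu) (k := k)) eta0.
pose K := Num.sqrt (\sum_k frob (A k - (lam 0 k)%:M) ^+ 2).
have K0 : 0 <= K by exact: sqrtr_ge0.
exists (K / e0 ^+ 2) => e ep theta Xt Yt [hth _] [hXt _ _ hcol].
set x := col i Xt; have x1 : frob x = 1 by exact: hcol.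
have hx : lincomb mu (perturb A E e) *m x = theta 0 i *: x.
  rewrite /x [col i Xt]colE mulmxA hXt -!colE.
  apply/colP => l; rewrite !mxE (bigD1 i)//= big1 ?addr0 => [|m mi].
    by rewrite !mxE eqxx mulr1n mulrC.
  by rewrite !mxE (negPf mi) mulr0n mulr0.
have split2 : frob (rayleigh (perturb A E e) x - lam) <=
    frob (rayleigh (fun k => A k - (lam 0 k)%:M) x) + e.
  rewrite rayleigh_perturb_sub//; apply: le_trans (ler_frobD _ _) _.
  rewrite lerD2l frobZ normc_real gtr0_norm// -[leRHS]mulr1 ler_wpM2l ?(ltW ep)//.
  by apply: le_trans (frob_rayleigh_le _ x1) _; rewrite hE sqrtr1.
apply: le_trans split2 _; rewrite [(1 + _) * e]mulrDl mul1r -addrA [leRHS]addrC lerD2r.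
have S0 : 0 <= specnorm X2 * specnorm Y2 * r * e.
  by rewrite !mulr_ge0 ?specnorm_ge0// ltW.
have [ee0|ee0] := ltP e e0; last first.
  apply: le_trans (frob_rayleigh_le _ x1) _; rewrite -/K.
  apply: le_trans (_ : K / e0 ^+ 2 * e ^+ 2 <= _); last by rewrite lerDr.
  rewrite mulrAC ler_pdivlMr ?exprn_gt0// ler_wpM2l//.
  by rewrite lerXn2r ?nnegrE ?(ltW e00) ?(ltW ep).
apply: le_trans (_ : specnorm X2 * specnorm Y2 * r * e <= _); last first.
  by rewrite lerDl mulr_ge0 ?divr_ge0 ?sqr_ge0.
apply: (frob_rayleigh_sub_le ep (ltW r0) x1 hx) => j gj.
have thc : normc (theta 0 i - lineval mu lam) <= eta.
  by apply: (near e ep ee0); rewrite -lincomb_perturb.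
rewrite mulrC -ler_pdivrMr//.
have tri : normc (lineval mu (eig_gap j)) <=
    normc (theta 0 i - lincomb mu A22 j j) + normc (theta 0 i - lineval mu lam).
  rewrite lineval_eig_gap -[X in _ <= X + _]normcN.
  by apply: le_trans (le_normcD _ _); rewrite opprB addrA subrK.
have := etaP j gj; rewrite /gapd => h; move: h thc tri; lra.
Qed.

End FixedPerturbation.

End DeterministicBound.

(** * Expectations of bounded measurable functions *)

Section BoundedExpectation.
Context (d : measure_display) (T : measurableType d) (R : realType)
  (P : probability T R).
Implicit Types (f g : T -> R) (A : set T).

Definition bounded_measurable f :=
  measurable_fun setT f /\ exists M, forall x, `|f x| <= M.

Definition expect f : R := \int[P]_x f x.

Lemma bounded_measurable_integrable f :
  bounded_measurable f -> P.-integrable setT (EFin \o f).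
Proof.
move=> [mf [M hM]]; apply: measurable_bounded_integrable => //.
  by rewrite -ge0_fin_numE ?fin_num_measure.
exists M; split; first exact: num_real.
by move=> M' MM' x _; exact: le_trans (hM x) (ltW MM').
Qed.

Lemma bounded_measurable_cst (c : R) : bounded_measurable (fun=> c).
Proof. by split; [exact: measurable_cst | exists `|c|]. Qed.

Lemma bounded_measurableD f g :
  bounded_measurable f -> bounded_measurable g ->
  bounded_measurable (fun x => f x + g x).
Proof.
move=> [mf [M hM]] [mg [N hN]]; split; first exact: measurable_funD.
by exists (M + N) => x; rewrite (le_trans (ler_normD _ _))// lerD.
Qed.

Lemma bounded_measurableM f g :
  bounded_measurable f -> bounded_measurable g ->
  bounded_measurable (fun x => f x * g x).
Proof.
move=> [mf [M hM]] [mg [N hN]]; split; first exact: measurable_funM.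
by exists (M * N) => x; rewrite normrM ler_pM.
Qed.

Lemma bounded_measurableX f n :
  bounded_measurable f -> bounded_measurable (fun x => f x ^+ n).
Proof.
move=> [mf [M hM]]; split; first exact: measurable_funX.
by exists (M ^+ n) => x; rewrite normrX lerXn2r ?nnegrE// (le_trans _ (hM x)).
Qed.

Lemma bounded_measurable_sum (I : finType) (F : I -> T -> R) :
  (forall i, bounded_measurable (F i)) ->
  bounded_measurable (fun x => \sum_i F i x).
Proof.
move=> hF; split; first by apply: measurable_sum => i; case: (hF i).
have /choice[M hM] i := proj2 (hF i).
by exists (\sum_i M i) => x; rewrite (le_trans (ler_norm_sum _ _ _))// ler_sum.
Qed.

Lemma bounded_measurable_indic A : measurable A -> bounded_measurable (\1_A).
Proof.
move=> mA; split; first exact: measurable_indic.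
by exists 1 => x; rewrite indicE; case: (_ \in _); rewrite ?normr1 ?normr0.
Qed.

Lemma expect_cst (c : R) : expect (fun=> c) = c.
Proof.
rewrite /expect Rintegral_cst// [X in fine X](_ : _ = 1%E) ?mulr1//.
exact: probability_setT.
Qed.

Lemma expectD f g : bounded_measurable f -> bounded_measurable g ->
  expect (fun x => f x + g x) = expect f + expect g.
Proof.
by move=> bf bg; rewrite /expect RintegralD//; exact: bounded_measurable_integrable.
Qed.

Lemma expectZ (c : R) f : bounded_measurable f ->
  expect (fun x => c * f x) = c * expect f.
Proof.
by move=> bf; rewrite /expect RintegralZl//; exact: bounded_measurable_integrable.
Qed.

Lemma expect_sum (I : finType) (F : I -> T -> R) :
  (forall i, bounded_measurable (F i)) ->
  expect (fun x => \sum_i F i x) = \sum_i expect (F i).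
Proof.
move=> hF.
have : forall s : seq I, bounded_measurable (fun x => \sum_(i <- s) F i x) /\
   expect (fun x => \sum_(i <- s) F i x) = \sum_(i <- s) expect (F i).
  elim=> [|i s [bs IH]].
    under eq_fun do rewrite big_nil.
    by split; [exact: bounded_measurable_cst | rewrite expect_cst big_nil].
  under eq_fun do rewrite big_cons.
  by split; [exact: bounded_measurableD | rewrite expectD// IH big_cons].
by move=> /(_ (index_enum I)) [].
Qed.

Lemma le_expect f g : bounded_measurable f -> bounded_measurable g ->
  (forall x, f x <= g x) -> expect f <= expect g.
Proof.
move=> bf bg fg; apply: le_Rintegral => //; exact: bounded_measurable_integrable.
Qed.

Lemma expect_indic A : measurable A -> (expect (\1_A))%:E = P A.
Proof.
move=> mA; rewrite /expect /Rintegral fineK.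
  by rewrite integral_indic// setIT.
by rewrite integral_indic// setIT fin_num_measure.
Qed.

Lemma measurable_set_le f g : measurable_fun setT f -> measurable_fun setT g ->
  measurable [set x | f x <= g x].
Proof.
move=> mf mg; have := measurable_fun_ler mf mg.
move=> /(_ measurableT [set true] I); rewrite setTI.
by congr measurable; apply/seteqP; split.
Qed.

Lemma measurable_set_eq f g : measurable_fun setT f -> measurable_fun setT g ->
  measurable [set x | f x = g x].
Proof.
move=> mf mg; have := measurable_fun_eqr mf mg.
move=> /(_ measurableT [set true] I); rewrite setTI.
by congr measurable; apply/seteqP; split => x /eqP.
Qed.

End BoundedExpectation.

(** * Averages over roots of unity and Bernstein polynomials *)

Section RootsOfUnityAverage.
Context (C : numClosedFieldType).

Lemma closed_prim_root_exists n : (0 < n)%N -> exists z : C, n.-primitive_root z.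
Proof.
move=> n_gt0; have [r Dp] := closed_field_poly_normal ('X^n - 1 : {poly C}).
rewrite (monicP _) ?monicXnsubC // scale1r in Dp.
have rn1 : all n.-unity_root r by apply/allP => z; rewrite -root_prod_XsubC -Dp.
have sz_r : (n < (size r).+1)%N.
  by rewrite -(size_prod_XsubC r id) -Dp size_XnsubC.
have [|z] := hasP (has_prim_root n_gt0 rn1 _ sz_r); last by exists z.
by rewrite -separable_prod_XsubC -Dp separable_Xn_sub_1 // pnatr_eq0 -lt0n.
Qed.

Lemma prim_root_norm1 n (z : C) : n.-primitive_root z -> `|z| = 1.
Proof.
move=> pz; have n0 := prim_order_gt0 pz; apply/eqP.
by rewrite -(pexpr_eq1 n0)// -normrX (prim_expr_order pz) normr1.
Qed.

(** Orthogonality of the characters of the cyclic group of order [n]. *)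
Lemma sum_prim_root n (z : C) l m : n.-primitive_root z -> (l < n)%N -> (m < n)%N ->
  \sum_(t < n) (z ^+ t) ^+ l * Num.conj ((z ^+ t) ^+ m) = (n * (l == m))%N%:R.
Proof.
move=> pz ln mn; have z1 := prim_root_norm1 pz.
have zz : z * Num.conj z = 1 by rewrite -normCK z1 expr1n.
pose w := z ^+ l * Num.conj (z ^+ m).
have -> : \sum_(t < n) (z ^+ t) ^+ l * Num.conj ((z ^+ t) ^+ m) = \sum_(t < n) w ^+ t.
  apply: eq_bigr => t _; rewrite /w exprMn -!exprM mulnC.
  by rewrite -rmorphXn -exprM [(m * t)%N]mulnC.
have wm : w * z ^+ m = z ^+ l.
  by rewrite /w -mulrA [_ * z ^+ m]mulrC rmorphXn -exprMn zz expr1n mulr1.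
have [lm|lm] := eqVneq l m.
  have -> : w = 1 by rewrite /w lm rmorphXn -exprMn zz expr1n.
  under eq_bigr do rewrite expr1n.
  by rewrite sumr_const card_ord muln1.
rewrite muln0; apply/eqP.
have w1 : w - 1 != 0.
  rewrite subr_eq0; apply: contra lm => /eqP w1.
  move: wm; rewrite w1 mul1r => /eqP; rewrite (eq_prim_root_expr pz).
  by rewrite !modn_small// eq_sym.
rewrite -(mulrI_eq0 _ (lregP w1)) -subrX1 subr_eq0 /w exprMn -rmorphXn.
rewrite -!exprM [(l * n)%N]mulnC [(m * n)%N]mulnC !exprM (prim_expr_order pz).
by rewrite !expr1n rmorph1 mulr1.
Qed.

(** Averaging over the phase leaves only the diagonal terms of the product of
    the two binomial expansions. *)
Lemma sum_prim_root_norm n (z a b : C) k : n.-primitive_root z -> (k < n)%N ->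
  \sum_(t < n) `|a + z ^+ t * b| ^+ (2 * k) =
  n%:R * \sum_(l < k.+1) ('C(k, l) ^ 2)%N%:R * `|a| ^+ (2 * (k - l)) * `|b| ^+ (2 * l).
Proof.
move=> pz kn.
have E (t : nat) : `|a + z ^+ t * b| ^+ (2 * k) =
  \sum_(l < k.+1) \sum_(m < k.+1)
    (('C(k, l) * 'C(k, m))%N%:R * (a ^+ (k - l) * b ^+ l) *
      Num.conj (a ^+ (k - m) * b ^+ m)) * ((z ^+ t) ^+ l * Num.conj ((z ^+ t) ^+ m)).
  rewrite exprM normCK exprMn -rmorphXn exprDn rmorph_sum big_distrlr /=.
  apply: eq_bigr => l _; apply: eq_bigr => m _.
  have cE : Num.conj (a ^+ (k - m) * (z ^+ t * b) ^+ m *+ 'C(k, m)) =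
      'C(k, m)%:R * Num.conj (a ^+ (k - m) * b ^+ m) * Num.conj ((z ^+ t) ^+ m).
    have cM (x y : C) : Num.conj (x * y) = Num.conj x * Num.conj y by exact: rmorphM.
    rewrite -mulr_natl exprMn !cM rmorph_nat.
    move: (Num.conj _) (Num.conj _) (Num.conj _) => *; ring.
  rewrite cE natrM exprMn -mulr_natl.
  have mulACA6 (p q x1 x2 x3 x4 x5 : C) :
      p * (x4 * (x3 * x5)) * (q * x1 * x2) = p * q * (x4 * x5) * x1 * (x3 * x2).
    by ring.
  exact: mulACA6.
under eq_bigr do rewrite E.
rewrite exchange_big mulr_sumr; apply: eq_bigr => l _ /=.
rewrite exchange_big /= (bigD1 l)//= [X in _ + X]big1 => [|m ml]; last first.
  rewrite -mulr_sumr (sum_prim_root pz) ?(leq_trans _ kn)//.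
  by rewrite -val_eqE eq_sym in ml; rewrite (negPf ml) muln0 mulr0.
rewrite addr0 -mulr_sumr (sum_prim_root pz) ?(leq_trans _ kn)// eqxx muln1.
have nE (x : C) e : `|x| ^+ (2 * e) = x ^+ e * Num.conj (x ^+ e).
  by rewrite exprM normCK exprMn rmorphXn.
rewrite !nE -mulnn.
have cM (x y : C) : Num.conj (x * y) = Num.conj x * Num.conj y by exact: rmorphM.
rewrite cM; move: (a ^+ _) (b ^+ _) => x y; ring.
Qed.

End RootsOfUnityAverage.

Section Bernstein.
Context (R : realFieldType).
Implicit Types (v w : R) (f : nat -> R).

(** When [v + w = 1], the expectation of [f] under the binomial law with [k]
    trials and success probability [v]. *)
Definition bernstein_sum k v w f : R :=
  \sum_(l < k.+1) 'C(k, l)%:R * v ^+ l * w ^+ (k - l) * f l.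

(** One more trial: the last one is a failure (weight [w]) or a success
    (weight [v]). *)
Lemma bernstein_sumS k v w f :
  bernstein_sum k.+1 v w f =
  w * bernstein_sum k v w f + v * bernstein_sum k v w (f \o succn).
Proof.
rewrite /bernstein_sum big_ord_recl [in X in w * X]big_ord_recl /=.
rewrite !bin0 !expr0 !subn0 !mul1r mulrDr -addrA; congr (_ + _).
  by rewrite exprS; ring.
under eq_bigr do rewrite /bump /= add1n binS natrD !mulrDl subSS.
rewrite big_split /=; congr (_ + _); last first.
  by rewrite mulr_sumr; apply: eq_bigr => l _; rewrite exprS; ring.
rewrite big_ord_recr /= bin_small ?ltnSn// !mul0r addr0 mulr_sumr.
apply: eq_bigr => l _; rewrite /bump /= add1n.
have -> : (k - l = (k - l.+1).+1)%N by rewrite subnSK.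
by rewrite [w ^+ _.+1]exprS; ring.
Qed.

Lemma bernstein_sum1 k v w : bernstein_sum k v w (fun=> 1) = (v + w) ^+ k.
Proof.
rewrite /bernstein_sum [v + w]addrC exprDn; apply: eq_bigr => l _.
by rewrite mulr1 -mulr_natl; ring.
Qed.

Lemma bernstein_sum_variance k v w c : v + w = 1 ->
  bernstein_sum k v w (fun l => (l%:R - c) ^+ 2) =
  k%:R * v * w + (k%:R * v - c) ^+ 2.
Proof.
move=> vw; have -> : w = 1 - v by rewrite -vw addrC addKr.
elim: k c => [|k IH] c.
  by rewrite /bernstein_sum big_ord1 bin0 sub0n !expr0 /=; ring.
rewrite bernstein_sumS IH.
have -> : (fun l => (l%:R - c) ^+ 2) \o succn =
    (fun l => (l%:R - (c - 1)) ^+ 2) :> (nat -> R).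
  by apply/funext => l /=; rewrite -natr1; ring.
by rewrite IH -natr1; ring.
Qed.

Lemma count_le_real (n : nat) (c : R) : 0 <= c ->
  \sum_(j < n) (if j%:R <= c then 1 else 0 : R) <= c + 1.
Proof.
move=> c0; elim: n => [|n IH]; first by rewrite big_ord0 addr_ge0.
rewrite big_ord_recr /=; case: ifPn => [nc|_]; last by rewrite addr0.
rewrite lerD2r; apply: le_trans nc.
apply: le_trans (_ : \sum_(j < n) 1 <= _).
  by apply: ler_sum => j _; case: ifP.
by rewrite sumr_const card_ord.
Qed.

(** Chebyshev's inequality for the binomial law with success probability [v],
    whose variance divided by [k ^ 2] is at most [1 / k]. *)
Lemma bernstein_chebyshev k v w c delta : 0 <= v -> 0 <= w -> v + w = 1 ->
  v <= c -> 0 < delta -> (0 < k)%N ->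
  1 <= bernstein_sum k v w (fun l => if l%:R <= (c + delta) * k%:R then 1 else 0) +
    (delta ^+ 2 * k%:R)^-1.
Proof.
move=> v0 w0 vw vc d0 k0.
have kR0 : 0 < k%:R :> R by rewrite ltr0n.
have dk : 0 < delta * k%:R by rewrite mulr_gt0.
pose g l := (l%:R - k%:R * v) ^+ 2 / (delta * k%:R) ^+ 2.
have gE : bernstein_sum k v w g <= (delta ^+ 2 * k%:R)^-1.
  have -> : bernstein_sum k v w g =
      bernstein_sum k v w (fun l => (l%:R - k%:R * v) ^+ 2) / (delta * k%:R) ^+ 2.
    by rewrite /bernstein_sum mulr_suml; apply: eq_bigr => l _; rewrite mulrA.
  rewrite bernstein_sum_variance// subrr expr0n addr0.
  have -> : k%:R * v * w / (delta * k%:R) ^+ 2 = (delta ^+ 2 * k%:R)^-1 * (v * w).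
    by field; rewrite !gt_eqF.
  apply: ler_piMr; first by rewrite invr_ge0 mulr_ge0 ?sqr_ge0.
  by apply: mulr_ile1 => //; lra.
apply: le_trans (lerD (lexx _) gE).
have {1}-> : 1 = bernstein_sum k v w (fun=> 1) by rewrite bernstein_sum1 vw expr1n.
rewrite /bernstein_sum -big_split /=; apply: ler_sum => l _.
rewrite -mulrDr ler_wpM2l ?mulr_ge0 ?exprn_ge0//.
case: ifPn => [_|]; first by rewrite lerDl divr_ge0 ?sqr_ge0.
rewrite -ltNge => lk; rewrite add0r ler_pdivlMr ?exprn_gt0// mul1r.
have : delta * k%:R <= l%:R - k%:R * v.
  rewrite lerBrDr; apply: le_trans (ltW lk).
  by rewrite mulrDl addrC lerD2r mulrC ler_wpM2r.
by move=> h; rewrite lerXn2r ?nnegrE ?(ltW dk)// (le_trans (ltW dk) h).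
Qed.

(** Coefficients are compared at the natural numbers, infinitely many points. *)
Lemma poly_eq_nat (a b : nat -> R) n :
  (forall u : nat, \sum_(l < n) a l * u%:R ^+ l = \sum_(l < n) b l * u%:R ^+ l) ->
  forall l, (l < n)%N -> a l = b l.
Proof.
move=> H l ln.
pose p : {poly R} := \poly_(j < n) (a j - b j).
have p0 : p = 0.
  apply/eqP; apply: contraT => pn0.
  have := max_poly_roots pn0 (rs := [seq (i%:R : R) | i <- iota 0 (size p)]).
  rewrite size_map size_iota ltnn; apply.
    apply/allP => _ /mapP[u _ ->]; rewrite /root /p horner_poly.
    under eq_bigr do rewrite mulrBl.
    by rewrite sumrB H subrr.
  by rewrite map_inj_uniq ?iota_uniq//; apply: mulrIn; rewrite oner_eq0.
have := congr1 (fun q : {poly R} => q`_l) p0.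
by rewrite /p coef_poly ln coef0 => /eqP; rewrite subr_eq0 => /eqP.
Qed.

End Bernstein.

(** * Complex coordinates and plane rotations *)

Section ComplexCoordinates.
Context (R : realType).
Local Notation normc := ComplexField.Normc.normc.

Lemma sqr_normcE (z : R[i]) : normc z ^+ 2 = complex.Re z ^+ 2 + complex.Im z ^+ 2.
Proof. by case: z => a b /=; rewrite sqr_sqrtr// addr_ge0 ?sqr_ge0. Qed.

Lemma complex_ReD (y z : R[i]) : complex.Re (y + z) = complex.Re y + complex.Re z.
Proof. by case: y z => ? ? []. Qed.

Lemma complex_ImD (y z : R[i]) : complex.Im (y + z) = complex.Im y + complex.Im z.
Proof. by case: y z => ? ? []. Qed.

Lemma complex_ReM (y z : R[i]) : complex.Re (y * z) =
  complex.Re y * complex.Re z - complex.Im y * complex.Im z.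
Proof. by case: y z => ? ? []. Qed.

Lemma complex_ImM (y z : R[i]) : complex.Im (y * z) =
  complex.Re y * complex.Im z + complex.Im y * complex.Re z.
Proof. by case: y z => ? ? []. Qed.

Lemma sum_prim_root_normc n (z a b : R[i]) k : n.-primitive_root z -> (k < n)%N ->
  \sum_(t < n) (normc (a + z ^+ t * b) ^+ 2) ^+ k =
  n%:R * \sum_(l < k.+1)
    ('C(k, l) ^ 2)%N%:R * (normc a ^+ 2) ^+ (k - l) * (normc b ^+ 2) ^+ l.
Proof.
move=> pz kn; apply: complexI.
have := sum_prim_root_norm a b pz kn.
rewrite (rmorph_sum (real_complex R)) (rmorphM (real_complex R)) rmorph_nat.
rewrite (rmorph_sum (real_complex R)) => H.
transitivity (\sum_(t < n) `|a + z ^+ t * b| ^+ (2 * k)).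
  by apply: eq_bigr => t _; rewrite !rmorphXn /= normr_normc exprM.
rewrite H; congr (_ * _); apply: eq_bigr => l _.
by rewrite !(rmorphM (real_complex R)) rmorph_nat !rmorphXn /= !normr_normc !exprM.
Qed.

End ComplexCoordinates.

Section GivensRotation.
Context (R : realType) (d : nat) (i j : 'I_d) (a b : R[i]).
Context (ij : i != j) (ab : a * Num.conj a + b * Num.conj b = 1).

Definition givens : 'M[R[i]]_d := \matrix_(r, l)
  if l == i then a * (r == i)%:R + b * (r == j)%:R
  else if l == j then - Num.conj b * (r == i)%:R + Num.conj a * (r == j)%:R
  else (r == l)%:R.

Lemma sum_two_deltas (al be : R[i]) (g : 'I_d -> R[i]) :
  \sum_r (al * (r == i)%:R + be * (r == j)%:R) * g r = al * g i + be * g j.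
Proof.
rewrite (bigD1 i)//= (bigD1 j) 1?eq_sym//= big1 => [|r /andP[/negPf ri /negPf rj]].
  by rewrite !eqxx [j == i]eq_sym (negPf ij) /=; ring.
by rewrite ri rj /=; ring.
Qed.

Lemma givens_unitary : givens \is unitarymx.
Proof.
have ij' := negPf ij; have ji : (j == i) = false by rewrite eq_sym.
apply/unitarymxP/mulmx1C/matrixP => l m; rewrite !mxE.
under eq_bigr do rewrite !mxE.
have [->|li] := eqVneq l i.
  under eq_bigr => r _ do rewrite rmorphD !rmorphM !rmorph_nat.
  rewrite sum_two_deltas !eqxx ij' ji [i == m]eq_sym [j == m]eq_sym.
  have [mi|mi] := eqVneq m i; first by apply: etrans ab; rewrite /=; ring.
  by have [mj|mj] := eqVneq m j; rewrite /=; ring.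
have [->|lj] := eqVneq l j.
  under eq_bigr => r _ do rewrite rmorphD !rmorphM !rmorph_nat rmorphN /= !conjCK.
  rewrite sum_two_deltas !eqxx ij' ji [i == m]eq_sym [j == m]eq_sym.
  have [mi|mi] := eqVneq m i; first by rewrite mi ij' /=; ring.
  have [mj|mj] := eqVneq m j; first by apply: etrans ab; rewrite /=; ring.
  by rewrite /=; ring.
under eq_bigr => r _ do rewrite rmorph_nat.
rewrite (bigD1 l)//= big1 => [|r /negPf rl]; last by rewrite rl mul0r.
rewrite eqxx mul1r addr0 (negPf li) (negPf lj).
have [mi|mi] := eqVneq m i; first by rewrite mi (negPf li) /=; ring.
by have [mj|mj] := eqVneq m j; first by rewrite mj (negPf lj) /=; ring.
Qed.

Lemma mulmx_givens_l (x : 'rV[R[i]]_d) : (x *m givens) 0 i = a * x 0 i + b * x 0 j.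
Proof.
rewrite mxE; under eq_bigr do rewrite !mxE eqxx mulrC.
exact: sum_two_deltas.
Qed.

Lemma mulmx_givens_r (x : 'rV[R[i]]_d) :
  (x *m givens) 0 j = - Num.conj b * x 0 i + Num.conj a * x 0 j.
Proof.
rewrite mxE; under eq_bigr do rewrite !mxE eqxx eq_sym (negPf ij) mulrC.
exact: sum_two_deltas.
Qed.

Lemma givens_sqr_norm (x : 'rV[R[i]]_d) :
  ComplexField.Normc.normc ((x *m givens) 0 i) ^+ 2 +
    ComplexField.Normc.normc ((x *m givens) 0 j) ^+ 2 =
  ComplexField.Normc.normc (x 0 i) ^+ 2 + ComplexField.Normc.normc (x 0 j) ^+ 2.
Proof.
apply: complexI; rewrite mulmx_givens_l mulmx_givens_r.
rewrite !(rmorphD (real_complex R)) !(rmorphXn (real_complex R)) /=.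
rewrite -!normr_normc !normCK !rmorphD !rmorphM rmorphN /= !conjCK.
by rewrite -[RHS]mul1r -ab; ring.
Qed.

End GivensRotation.

(** * Measurability and unitary invariance *)

Section UniformOnSphere.
Context (R : realType) (d : nat) (Q : probability (borelCvec R d) R).
Context (hQ : uniform_on_sphere Q).
Local Notation T := (borelCvec R d).
Local Notation normc := ComplexField.Normc.normc.

Lemma measurable_coord_Re k :
  measurable_fun [set: T] (fun x : 'rV[R[i]]_d => complex.Re (x 0 k)).
Proof.
move=> _ B mB; rewrite setTI; apply: sub_sigma_algebra.
by exists k, B; split => //; left.
Qed.

Lemma measurable_coord_Im k :
  measurable_fun [set: T] (fun x : 'rV[R[i]]_d => complex.Im (x 0 k)).
Proof.
move=> _ B mB; rewrite setTI; apply: sub_sigma_algebra.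
by exists k, B; split => //; right.
Qed.

Lemma measurable_lin_Re (c : 'I_d -> R[i]) :
  measurable_fun [set: T] (fun x : 'rV[R[i]]_d => complex.Re (\sum_l x 0 l * c l)).
Proof.
under eq_fun => x do rewrite (big_morph _ (@complex_ReD R) (erefl (complex.Re 0))).
apply: measurable_sum => l; under eq_fun => x do rewrite complex_ReM.
by apply: measurable_funB; apply: measurable_funM => //;
  [exact: measurable_coord_Re | exact: measurable_coord_Im].
Qed.

Lemma measurable_lin_Im (c : 'I_d -> R[i]) :
  measurable_fun [set: T] (fun x : 'rV[R[i]]_d => complex.Im (\sum_l x 0 l * c l)).
Proof.
under eq_fun => x do rewrite (big_morph _ (@complex_ImD R) (erefl (complex.Im 0))).
apply: measurable_sum => l; under eq_fun => x do rewrite complex_ImM.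
by apply: measurable_funD; apply: measurable_funM => //;
  [exact: measurable_coord_Re | exact: measurable_coord_Im].
Qed.

Lemma measurable_sqr_normc_lin (c : 'I_d -> R[i]) :
  measurable_fun [set: T] (fun x : 'rV[R[i]]_d => normc (\sum_l x 0 l * c l) ^+ 2).
Proof.
under eq_fun => x do rewrite sqr_normcE.
by apply: measurable_funD; apply: measurable_funX;
  [exact: measurable_lin_Re | exact: measurable_lin_Im].
Qed.

Lemma measurable_sqr_normc_coord k :
  measurable_fun [set: T] (fun x : 'rV[R[i]]_d => normc (x 0 k) ^+ 2).
Proof.
under eq_fun => x do rewrite sqr_normcE.
by apply: measurable_funD; apply: measurable_funX;
  [exact: measurable_coord_Re | exact: measurable_coord_Im].
Qed.

Definition right_mul (U : 'M[R[i]]_d) : T -> T := fun x : 'rV[R[i]]_d => x *m U.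

Lemma measurable_right_mul (U : 'M[R[i]]_d) : measurable_fun [set: T] (right_mul U).
Proof.
apply: (@measurability _ _ T T _ _ (@coordinate_sets R d)) => //.
move=> _ [_ [k [B [mB [->|->]]]] <-]; rewrite setTI.
- rewrite [X in measurable X](_ : _ =
    (fun x : 'rV[R[i]]_d => complex.Re (\sum_l x 0 l * U l k)) @^-1` B).
    by rewrite -[X in measurable X]setTI; exact: measurable_lin_Re.
  by apply/seteqP; split => x /=; rewrite mxE.
- rewrite [X in measurable X](_ : _ =
    (fun x : 'rV[R[i]]_d => complex.Im (\sum_l x 0 l * U l k)) @^-1` B).
    by rewrite -[X in measurable X]setTI; exact: measurable_lin_Im.
  by apply/seteqP; split => x /=; rewrite mxE.
Qed.

Lemma expect_right_mul (U : 'M[R[i]]_d) (f : T -> R) :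
  U \is unitarymx -> bounded_measurable f ->
  expect Q (f \o right_mul U) = expect Q f.
Proof.
move=> uU bf; have mU := measurable_right_mul U; have [mf [M hM]] := bf.
rewrite /expect /Rintegral; congr fine.
have bfU : bounded_measurable (f \o right_mul U).
  by split; [exact: measurableT_comp | exists M => x; exact: hM].
transitivity (\int[pushforward Q (right_mul U)]_y (f y)%:E)%E.
  rewrite (integral_pushforward mU) ?preimage_setT//.
    exact/measurable_EFinP.
  exact: (bounded_measurable_integrable Q bfU).
apply: eq_measure_integral => A mA _.
exact: (proj2 hQ).
Qed.

End UniformOnSphere.

(** * The ratio of two squared coordinates is uniform *)

Section PairRatio.
Context (R : realType) (d : nat) (Q : probability (borelCvec R d) R).
Context (hQ : uniform_on_sphere Q).
Context (i j : 'I_d).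
Context (ij : i != j).
Local Notation T := (borelCvec R d).
Local Notation normc := ComplexField.Normc.normc.

Definition pair_sqr_norm (x : 'rV[R[i]]_d) : R :=
  normc (x 0 i) ^+ 2 + normc (x 0 j) ^+ 2.

(** When both coordinates vanish the two ratios are [0 / 0 = 0], so that their
    sum is 0 instead of 1. *)
Definition pair_ratio (k : 'I_d) (x : 'rV[R[i]]_d) : R :=
  normc (x 0 k) ^+ 2 * (pair_sqr_norm x)^-1.

Lemma pair_sqr_norm_ge0 x : 0 <= pair_sqr_norm x.
Proof. by rewrite addr_ge0 ?sqr_ge0. Qed.

Lemma pair_ratio_ge0 k x : 0 <= pair_ratio k x.
Proof. by rewrite mulr_ge0 ?sqr_ge0 ?invr_ge0 ?pair_sqr_norm_ge0. Qed.

Lemma pair_ratio_sum x : pair_sqr_norm x != 0 -> pair_ratio i x + pair_ratio j x = 1.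
Proof. by move=> x0; rewrite -mulrDl divff. Qed.

Lemma pair_ratio_sum_le1 x : pair_ratio i x + pair_ratio j x <= 1.
Proof.
have [x0|x0] := eqVneq (pair_sqr_norm x) 0; last by rewrite pair_ratio_sum.
by rewrite /pair_ratio x0 invr0 !mulr0 addr0 ler01.
Qed.

Lemma pair_ratio_bounded_measurable k : (k == i) || (k == j) ->
  bounded_measurable (pair_ratio k : T -> R).
Proof.
move=> kij; split.
  have -> : (pair_ratio k : T -> R) =
      (fun x : 'rV[R[i]]_d => normc (x 0 k) ^+ 2 * (pair_sqr_norm x) `^ (-1)).
    by apply/funext => x; rewrite /pair_ratio powR_inv1// pair_sqr_norm_ge0.
  apply: measurable_funM; first exact: measurable_sqr_normc_coord.
  apply: (measurableT_comp (@measurable_powR R (-1))).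
  by apply: measurable_funD; exact: measurable_sqr_normc_coord.
exists 1 => x; rewrite ger0_norm ?pair_ratio_ge0//.
have := pair_ratio_sum_le1 x; have := pair_ratio_ge0 i x; have := pair_ratio_ge0 j x.
by case/orP : kij => /eqP ->; lra.
Qed.

Lemma pair_ratio_monomial_bounded_measurable m l :
  bounded_measurable (fun x : T => pair_ratio i x ^+ m * pair_ratio j x ^+ l).
Proof.
by apply: bounded_measurableM; apply: bounded_measurableX;
  apply: pair_ratio_bounded_measurable; rewrite eqxx ?orbT.
Qed.

(** A rotation by the angle of tangent [sqrt u], combined with a phase [w], turns
    [x_i] into [(x_i + sqrt u w x_j) / sqrt (1 + u)] and preserves
    [pair_sqr_norm]. Averaging over the [k + 1]-th roots of unity [w] removes the
    cross terms of the [k]-th power. *)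
Lemma pair_ratio_rotation_average (k u : nat) : exists G : 'I_k.+1 -> 'M[R[i]]_d,
  (forall t, G t \is unitarymx) /\
  forall x : T, (1 + u%:R) ^+ k * \sum_t pair_ratio i (right_mul (G t) x) ^+ k =
    k.+1%:R * \sum_(l < k.+1) ('C(k, l) ^ 2)%N%:R * u%:R ^+ l *
      (pair_ratio i x ^+ (k - l) * pair_ratio j x ^+ l).
Proof.
have [z pz] := closed_prim_root_exists R[i] (ltn0Sn k).
have u0 : 0 <= 1 + u%:R :> R by rewrite addr_ge0.
have u1 : 1 + u%:R != 0 :> R by rewrite gt_eqF// ltr_pwDl.
pose al : R := (Num.sqrt (1 + u%:R))^-1.
have al2 : al ^+ 2 = (1 + u%:R)^-1 by rewrite exprVn sqr_sqrtr.
pose s : R := Num.sqrt u%:R.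
have s2 : s ^+ 2 = u%:R by rewrite sqr_sqrtr.
pose a : R[i] := al%:C; pose b (t : nat) : R[i] := (al * s)%:C * z ^+ t.
have ab t : a * Num.conj a + b t * Num.conj (b t) = 1.
  rewrite -!normCK normrM normrX (prim_root_norm1 pz) expr1n mulr1.
  rewrite !normr_normc !normc_real -!(rmorphXn (real_complex R)).
  rewrite -(rmorphD (real_complex R)) !real_normK ?num_real//.
  by rewrite exprMn s2 al2 -[X in X + _]mulr1 -mulrDr mulVf.
exists (fun t => givens i j a (b t)); split=> [t|x].
  by apply: givens_unitary.
have rho t : pair_sqr_norm (right_mul (givens i j a (b t)) x) = pair_sqr_norm x.
  exact: givens_sqr_norm.
have E t : pair_ratio i (right_mul (givens i j a (b t)) x) =
    (1 + u%:R)^-1 * (pair_sqr_norm x)^-1 *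
      normc (x 0 i + z ^+ t * (s%:C * x 0 j)) ^+ 2.
  rewrite /pair_ratio rho /right_mul (mulmx_givens_l _ _ ij).
  have -> : a * x 0 i + b t * x 0 j = a * (x 0 i + z ^+ t * (s%:C * x 0 j)).
    by rewrite /a /b (rmorphM (real_complex R)) /=; ring.
  rewrite ComplexField.Normc.normcM normc_real exprMn real_normK ?num_real// al2.
  by rewrite mulrAC.
under eq_bigr do rewrite E exprMn.
rewrite -mulr_sumr (sum_prim_root_normc _ _ pz (ltnSn k)).
rewrite exprMn !mulrA -exprMn mulfV// expr1n mul1r -mulrA mulrCA; congr (_ * _).
rewrite mulr_sumr; apply: eq_bigr => l _.
have -> : normc (s%:C * x 0 j) ^+ 2 = u%:R * normc (x 0 j) ^+ 2.
  by rewrite ComplexField.Normc.normcM normc_real exprMn real_normK ?num_real// s2.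
rewrite /pair_ratio !exprMn.
have lk : (l <= k)%N by rewrite -ltnS.
rewrite -[X in (pair_sqr_norm x)^-1 ^+ X](subnK lk) exprD.
move: (_ ^+ (k - l)) (_ ^+ (k - l)) => p1 p2; ring.
Qed.

(** Invariance under the rotations makes the moments of degree [k] satisfy a
    polynomial identity in [u], whose coefficients show that the [k + 1]
    Bernstein polynomials have the same expectation; their sum is at most 1.
    Unless both coordinates vanish with positive probability, these are the
    moments of a uniform variable on the unit interval. *)
Lemma expect_bernstein_le (k n : nat) : (n <= k)%N ->
  'C(k, n)%:R * expect Q (fun x : T => pair_ratio i x ^+ n * pair_ratio j x ^+ (k - n))
    <= k.+1%:R^-1.
Proof.
pose mom l := expect Q (fun x : T => pair_ratio i x ^+ (k - l) * pair_ratio j x ^+ l).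
pose m := expect Q (fun x : T => pair_ratio i x ^+ k).
have bm l : bounded_measurable (fun x : T => pair_ratio i x ^+ (k - l) * pair_ratio j x ^+ l).
  exact: pair_ratio_monomial_bounded_measurable.
have bk : bounded_measurable (fun x : T => pair_ratio i x ^+ k).
  by apply: bounded_measurableX; apply: pair_ratio_bounded_measurable; rewrite eqxx.
have bC (c : R) (f : T -> R) : bounded_measurable f -> bounded_measurable (fun x => c * f x).
  by move=> bf; apply: bounded_measurableM => //; exact: bounded_measurable_cst.
(* both sides are the expectation of the average of [V ^ k] over the rotations,
   times [(1 + u) ^ k], on the left by invariance and the binomial formula *)
have H (u : nat) : \sum_(l < k.+1) ('C(k, l)%:R * m) * u%:R ^+ l =
    \sum_(l < k.+1) (('C(k, l) ^ 2)%N%:R * mom l) * u%:R ^+ l.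
  have [G [uG hG]] := pair_ratio_rotation_average k u.
  have k0 : k.+1%:R != 0 :> R by rewrite pnatr_eq0.
  apply: (mulfI k0).
  transitivity (expect Q (fun x : T =>
      (1 + u%:R) ^+ k * \sum_t pair_ratio i (right_mul (G t) x) ^+ k)).
    have bG t : bounded_measurable ((fun x : T => pair_ratio i x ^+ k) \o right_mul (G t)).
      split; last by case: bk => _ [M hM]; exists M => x; exact: hM.
      by apply: measurableT_comp; [case: bk | exact: measurable_right_mul].
    rewrite expectZ ?expect_sum//; last exact: bounded_measurable_sum.
    rewrite [X in _ = _ * X](eq_bigr (fun=> m)) => [|t _]; last first.
      exact: (expect_right_mul hQ (uG t) bk).
    rewrite sumr_const card_ord -[m *+ _]mulr_natl mulrCA; congr (_ * _).
    rewrite exprDn mulr_suml; apply: eq_bigr => l _.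
    by rewrite expr1n mul1r -mulr_natl; ring.
  under eq_fun do rewrite hG.
  rewrite expectZ; last first.
    by apply: bounded_measurable_sum => l; apply: bC.
  rewrite expect_sum => [|l]; last exact: bC.
  congr (_ * _); apply: eq_bigr => l _.
  by rewrite expectZ// -/(mom l) mulrAC.
have momE l : (l <= k)%N -> 'C(k, l)%:R * mom l = m.
  move=> lk; have := @poly_eq_nat R (fun l => 'C(k, l)%:R * m)
    (fun l => ('C(k, l) ^ 2)%N%:R * mom l) k.+1 H l.
  rewrite ltnS => /(_ lk).
  have C0 : 'C(k, l)%:R != 0 :> R by rewrite pnatr_eq0 -lt0n bin_gt0.
  by rewrite -mulnn natrM -mulrA => /(mulfI C0) ->.
(* the Bernstein polynomials add up to at most 1 *)
have m1 : k.+1%:R * m <= 1.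
  rewrite -[leRHS](expect_cst Q).
  have -> : k.+1%:R * m = expect Q (fun x : T => (pair_ratio j x + pair_ratio i x) ^+ k).
    have E (x : T) : (pair_ratio j x + pair_ratio i x) ^+ k =
       \sum_(l < k.+1) 'C(k, l)%:R * (pair_ratio i x ^+ (k - l) * pair_ratio j x ^+ l).
      rewrite addrC exprDn; apply: eq_bigr => l _; rewrite -mulr_natl; ring.
    under eq_fun do rewrite E.
    rewrite expect_sum => [|l]; last exact: bC.
    under eq_bigr => l _ do rewrite expectZ// -/(mom l) momE -1?ltnS//.
    by rewrite sumr_const card_ord mulr_natl.
  apply: le_expect.
  - by apply: bounded_measurableX; apply: bounded_measurableD;
      apply: pair_ratio_bounded_measurable; rewrite eqxx ?orbT.
  - exact: bounded_measurable_cst.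
  - move=> x; rewrite exprn_ile1// ?addr_ge0 ?pair_ratio_ge0// addrC.
    exact: pair_ratio_sum_le1.
move=> nk; rewrite -[leRHS]mul1r ler_pdivlMr ?ltr0n// mulrC.
have := momE (k - n)%N (leq_subr _ _); rewrite /mom subKn// bin_sub// => ->.
exact: m1.
Qed.

Lemma measurable_small_pair_ratio (v : R) :
  measurable [set x : T | pair_sqr_norm x != 0 /\ pair_ratio i x <= v].
Proof.
have mr : measurable_fun [set: T] (pair_ratio i : T -> R).
  by case: (pair_ratio_bounded_measurable (k := i)); rewrite ?eqxx.
have mp : measurable_fun [set: T] (pair_sqr_norm : T -> R).
  by apply: measurable_funD; exact: measurable_sqr_normc_coord.
apply: measurableI; last by apply: measurable_set_le => //; exact: measurable_cst.
rewrite [X in measurable X](_ : _ = ~` [set x : T | pair_sqr_norm x = 0]).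
  by apply: measurableC; apply: measurable_set_eq => //; exact: measurable_cst.
by apply/seteqP; split => x /eqP.
Qed.

(** By Chebyshev's inequality for the Bernstein polynomials, the moments force
    [pair_ratio i] to be at most uniformly concentrated near 0. *)
Lemma prob_pair_ratio_le (v : R) : 0 <= v ->
  expect Q \1_[set x : T | pair_sqr_norm x != 0 /\ pair_ratio i x <= v] <= v.
Proof.
move=> v0.
have mA := measurable_small_pair_ratio v.
set A := [set _ | _] in mA *.
have key (delta : R) (k : nat) : 0 < delta -> (0 < k)%N ->
    expect Q \1_A <= v + delta + (1 + (delta ^+ 2)^-1) / k%:R.
  move=> d0 k0.
  have kR0 : 0 < k%:R :> R by rewrite ltr0n.
  pose g (l : nat) : R := if l%:R <= (v + delta) * k%:R then 1 else 0.
  have bt l : bounded_measurable (fun x : T => g l * 'C(k, l)%:R *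
       (pair_ratio i x ^+ l * pair_ratio j x ^+ (k - l))).
    apply: bounded_measurableM; first exact: bounded_measurable_cst.
    exact: pair_ratio_monomial_bounded_measurable.
  apply: le_trans (_ : expect Q (fun x : T => \sum_(l < k.+1) g l * 'C(k, l)%:R *
       (pair_ratio i x ^+ l * pair_ratio j x ^+ (k - l)) + (delta ^+ 2 * k%:R)^-1) <= _).
    apply: le_expect.
    - exact: bounded_measurable_indic.
    - apply: bounded_measurableD; last exact: bounded_measurable_cst.
      exact: bounded_measurable_sum.
    move=> x; rewrite indicE; have [xA|xA] := boolP (x \in A); last first.
      apply: addr_ge0; last by rewrite invr_ge0 mulr_ge0 ?sqr_ge0.
      apply: sumr_ge0 => l _.
      by rewrite !mulr_ge0 ?exprn_ge0 ?pair_ratio_ge0// /g; case: ifP.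
    have [x0 xv] := set_mem xA.
    have := bernstein_chebyshev (pair_ratio_ge0 i x) (pair_ratio_ge0 j x)
      (pair_ratio_sum x0) xv d0 k0.
    move=> /le_trans; apply; rewrite lerD2r /bernstein_sum; apply: ler_sum => l _.
    by rewrite le_eqVlt; apply/orP; left; apply/eqP; rewrite -/(g l); ring.
  rewrite expectD//; last 2 first.
  - exact: bounded_measurable_sum.
  - exact: bounded_measurable_cst.
  rewrite expect_sum// expect_cst.
  apply: le_trans (_ : \sum_(l < k.+1) g l * k.+1%:R^-1 + (delta ^+ 2 * k%:R)^-1 <= _).
    rewrite lerD2r; apply: ler_sum => l _.
    rewrite expectZ; last exact: pair_ratio_monomial_bounded_measurable.
    rewrite -mulrA ler_wpM2l//; first by rewrite /g; case: ifP.
    by apply: expect_bernstein_le; rewrite -ltnS.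
  rewrite -mulr_suml.
  have c0 : 0 <= (v + delta) * k%:R by rewrite mulr_ge0 ?addr_ge0 ?(ltW d0).
  have : \sum_(l < k.+1) g l <= (v + delta) * k%:R + 1 := count_le_real k.+1 c0.
  set S := \sum_(l < k.+1) g l => SE.
  have k1 : 0 < k.+1%:R :> R by rewrite ltr0n.
  have h1 : S / k.+1%:R <= v + delta + k%:R^-1.
    rewrite ler_pdivrMr//; apply: le_trans SE _.
    rewrite -natr1.
    have -> : (v + delta + k%:R^-1) * (k%:R + 1) =
        (v + delta) * k%:R + 1 + (v + delta + k%:R^-1) by field; rewrite gt_eqF.
    by rewrite lerDl !addr_ge0 ?invr_ge0 ?(ltW d0) ?(ltW kR0).
  have -> : v + delta + (1 + (delta ^+ 2)^-1) / k%:R =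
      v + delta + k%:R^-1 + (delta ^+ 2 * k%:R)^-1.
    by rewrite mulrDl mul1r [(delta ^+ 2 * _)^-1]invfM !addrA.
  by rewrite lerD2r.
apply/ler_addgt0Pr => e e0.
have e2 : 0 < e / 2 by rewrite divr_gt0.
pose c := 1 + ((e / 2) ^+ 2)^-1.
have c0 : 0 < c by rewrite ltr_pwDl// invr_ge0 sqr_ge0.
(* large enough for the last term of [key] with [delta = e / 2] to be at most
   [e / 2] *)
pose k := (Num.truncn (c / (e / 2))).+1.
have kb : c / (e / 2) < k%:R by exact: truncnS_gt.
have kR0 : 0 < k%:R :> R by rewrite ltr0n.
apply: le_trans (key (e / 2) k e2 _) _ => //.
have : c / k%:R <= e / 2.
  by rewrite ler_pdivrMr// mulrC -ler_pdivrMr// ltW.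
rewrite -/c; lra.
Qed.

End PairRatio.

(** * Small linear forms on the sphere *)

Section SmallLinearForms.
Context (R : realType) (d : nat) (Q : probability (borelCvec R d) R).
Context (hQ : uniform_on_sphere Q) (hd : (2 <= d)%N).
Local Notation T := (borelCvec R d).
Local Notation normc := ComplexField.Normc.normc.

Lemma sqr_frob_row (x : 'rV[R[i]]_d) : frob x ^+ 2 = \sum_k normc (x 0 k) ^+ 2.
Proof. by rewrite sqr_frob big_ord1. Qed.

Lemma frob_row_eq1 (x : 'rV[R[i]]_d) : frob x = 1 <-> \sum_k normc (x 0 k) ^+ 2 = 1.
Proof.
rewrite -sqr_frob_row; split=> [->|/eqP]; first by rewrite expr1n.
by rewrite sqrp_eq1 ?frob_ge0// => /eqP.
Qed.

Lemma measurable_sphere : measurable [set x : T | frob (x : 'rV[R[i]]_d) = 1].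
Proof.
rewrite [X in measurable X](_ : _ =
    [set x : T | \sum_k normc ((x : 'rV[R[i]]_d) 0 k) ^+ 2 = 1]).
  apply: measurable_set_eq; last exact: measurable_cst.
  by apply: measurable_sum => k; exact: measurable_sqr_normc_coord.
by apply/seteqP; split => x /=; rewrite frob_row_eq1.
Qed.

Lemma expect_off_sphere :
  expect Q \1_(~` [set x : T | frob (x : 'rV[R[i]]_d) = 1]) = 0.
Proof.
have mS := measurable_sphere; have mC := measurableC mS.
apply: EFin_inj; rewrite expect_indic// probability_setC//.
by rewrite (proj1 hQ) subee.
Qed.

(** One of the other coordinates has at least their average squared modulus
    [(1 - |x_i|^2) / (d - 1)], which is not small when [x_i] is. *)
Lemma small_coord_small_ratio (x : 'rV[R[i]]_d) (i : 'I_d) (s : R) :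
  frob x = 1 -> normc (x 0 i) ^+ 2 <= s ->
  exists2 k, k != i & pair_sqr_norm i k x != 0 /\ pair_ratio i k i x <= (d%:R - 1) * s.
Proof.
move=> /frob_row_eq1; set h := fun k => normc (x 0 k) ^+ 2.
rewrite -/(h i) -[\sum_k _]/(\sum_k h k) => h1 his.
have h0 k : 0 <= h k by exact: sqr_ge0.
have s0 : 0 <= s := le_trans (h0 i) his.
set D : R := d%:R - 1.
have DE : D = (#|predC1 i|)%:R.
  by rewrite cardC1 card_ord -subn1 natrB// (leq_trans _ hd).
have D1 : 1 <= D.
  by rewrite DE cardC1 card_ord ler1n; case: d hd => [|[]].
(* the other coordinates cannot all be below average *)
have [k ki hk] : exists2 k, k != i & 1 - h i <= D * h k.
  apply: contrapT => nk.
  have lt k : k != i -> D * h k < 1 - h i.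
    by move=> ki; rewrite ltNge; apply/negP => le; apply: nk; exists k.
  have [k0 k0i] : exists k0, k0 != i.
    have /card_gt0P[k0] : (0 < #|predC1 i|)%N.
      by rewrite cardC1 card_ord; case: d hd => [|[]].
    by rewrite inE => ?; exists k0.
  have S1 : \sum_(k | k != i) D * h k = D * (1 - h i).
    rewrite -mulr_sumr; congr (_ * _); apply/eqP.
    by rewrite eq_sym subr_eq addrC -h1 (bigD1 i).
  have : \sum_(k | k != i) D * h k < \sum_(k | k != i) (1 - h i).
    rewrite (bigD1 k0)//= [ltRHS](bigD1 k0)//=; apply: ltr_leD; first exact: lt.
    by apply: ler_sum => k /andP[ki _]; exact/ltW/lt.
  have S2 : \sum_(k | k != i) (1 - h i) = D * (1 - h i).
    by rewrite sumr_const DE mulr_natl; congr (_ *+ _); exact: eq_card.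
  by rewrite S1 S2 ltxx.
exists k => //; rewrite /pair_ratio /pair_sqr_norm -/(h i) -/(h k).
have hik : 0 < h i + h k.
  rewrite lt_neqAle addr_ge0// andbT eq_sym paddr_eq0//.
  apply/negP => /andP[/eqP i0 /eqP k0].
  by move: hk; rewrite i0 k0 mulr0 subr0 ler10.
split; first by rewrite gt_eqF.
rewrite ler_pdivrMr// -mulrA mulrCA.
have : 1 <= D * (h i + h k).
  rewrite mulrDr; apply: le_trans (_ : h i + (1 - h i) <= _); first by rewrite addrC subrK.
  by rewrite lerD// ler_peMl.
by move=> h2; rewrite (le_trans his)// ler_peMr.
Qed.

(** Union bound over the other coordinates: each ratio is at most [(d - 1) s]
    with probability at most [(d - 1) s]. *)
Lemma prob_small_coord (i : 'I_d) (s : R) : 0 <= s ->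
  expect Q \1_[set x : T | normc ((x : 'rV[R[i]]_d) 0 i) ^+ 2 <= s]
    <= (d%:R - 1) ^+ 2 * s.
Proof.
move=> s0; set D : R := d%:R - 1.
have DE : D = (#|predC1 i|)%:R.
  by rewrite cardC1 card_ord -subn1 natrB// (leq_trans _ hd).
have Ds : 0 <= D * s by rewrite DE mulr_ge0.
set A := [set _ | _].
have mA : measurable A.
  apply: measurable_set_le; last exact: measurable_cst.
  exact: measurable_sqr_normc_coord.
pose S := [set x : T | frob (x : 'rV[R[i]]_d) = 1].
have mS : measurable (~` S) by apply: measurableC; exact: measurable_sphere.
pose B k := [set x : T | pair_sqr_norm i k x != 0 /\ pair_ratio i k i x <= D * s].
have mB k : measurable (B k) by exact: measurable_small_pair_ratio.
pose F k (x : T) : R := (k != i)%:R * \1_(B k) x.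
have bF k : bounded_measurable (F k).
  apply: bounded_measurableM; first exact: bounded_measurable_cst.
  exact: bounded_measurable_indic.
apply: le_trans (_ : expect Q (fun x => \1_(~` S) x + \sum_k F k x) <= _).
  apply: le_expect; first exact: bounded_measurable_indic.
    apply: bounded_measurableD; first exact: bounded_measurable_indic.
    exact: bounded_measurable_sum.
  have F0 x k : 0 <= F k x by rewrite mulr_ge0// indicE.
  move=> x; have [xS|xS] := pselect (S x); last first.
    have -> : \1_(~` S) x = 1 :> R by rewrite indicE mem_set.
    apply: le_trans (_ : 1 <= _); last by rewrite lerDl sumr_ge0.
    by rewrite indicE; case: (_ \in _).
  have [xA|xA] := pselect (A x); last first.
    by rewrite {1}indicE memNset// addr_ge0 ?sumr_ge0 ?indicE.
  have [k ki xB] := small_coord_small_ratio xS xA.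
  rewrite (bigD1 k)//= addrCA; apply: le_trans (_ : F k x <= _).
    by rewrite /F ki mul1r !indicE mem_set// mem_set.
  by rewrite lerDl addr_ge0 ?sumr_ge0// indicE.
rewrite expectD ?expect_off_sphere ?add0r; last 2 first.
- exact: bounded_measurable_indic.
- exact: bounded_measurable_sum.
rewrite expect_sum//.
apply: le_trans (_ : \sum_k (k != i)%:R * (D * s) <= _).
  apply: ler_sum => k _; rewrite expectZ; last exact: bounded_measurable_indic.
  have [->|ki] := eqVneq k i; first by rewrite !mul0r.
  by rewrite !mul1r; apply: prob_pair_ratio_le; rewrite // eq_sym.
rewrite -mulr_suml expr2 -mulrA ler_wpM2r// -natr_sum DE ler_nat.
by rewrite -sum1_card [leqRHS]big_mkcond; apply: leq_sum => k _; rewrite inE; case: eqP.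
Qed.

(** Completing a vector to an orthogonal basis by the Gram-Schmidt process. *)
Lemma exists_unitary_col (dl : 'rV[R[i]]_d) :
  exists (i : 'I_d) (U : 'M[R[i]]_d) (c : R[i]),
  [/\ U \is unitarymx, normc c = frob dl &
      forall x : 'rV[R[i]]_d, \sum_k x 0 k * dl 0 k = c * (x *m U) 0 i].
Proof.
have d0 : (0 < d)%N by exact: leq_trans hd.
(* the process applied to a matrix with all rows equal to [dl] keeps the
   direction of the first row *)
pose i := Ordinal d0; pose A : 'M[R[i]]_d := \matrix_(r, l) dl 0 l.
have := row_schmidt_sub A i; set S := schmidt A.
have uS : S \is unitarymx by exact: schmidt_unitarymx.
have -> : row i A = dl by apply/rowP => l; rewrite !mxE.
rewrite (bigD1 i)//= big1 => [|k /andP[]]; last first.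
  by rewrite leqn0 => /eqP k0 /negP[]; apply/eqP/val_inj.
rewrite addsmx0 !genmxE => /sub_rVP[c dlE].
exists i, S^T, c; split.
- by rewrite trmx_unitary.
- rewrite dlE frobZ.
  suff -> : frob (row i S) = 1 by rewrite mulr1.
  apply/frob_row_eq1; apply: complexI; rewrite (rmorph_sum (real_complex R)).
  have /unitarymxP/matrixP/(_ i i) := uS; rewrite !mxE eqxx => H; apply: etrans H.
  apply: eq_bigr => k _; rewrite !mxE -normCK normr_normc.
  by rewrite (rmorphXn (real_complex R)).
- move=> x; rewrite mxE mulr_sumr; apply: eq_bigr => k _.
  by rewrite {1}dlE !mxE; ring.
Qed.

(** By unitary invariance every linear form is distributed as a multiple of a
    coordinate. *)
Lemma prob_small_linear_form (dl : 'rV[R[i]]_d) (t : R) : dl != 0 -> 0 <= t ->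
  expect Q \1_[set x : T | normc (lineval (x : 'rV[R[i]]_d) dl) <= frob dl * t]
    <= (d%:R - 1) ^+ 2 * t ^+ 2.
Proof.
move=> dl0 t0; have [i [U [c [uU cE xE]]]] := exists_unitary_col dl.
pose A := [set x : T | normc ((x : 'rV[R[i]]_d) 0 i) ^+ 2 <= t ^+ 2].
have mA : measurable A.
  apply: measurable_set_le; last exact: measurable_cst.
  exact: measurable_sqr_normc_coord.
apply: le_trans (prob_small_coord i (sqr_ge0 t)).
rewrite -/A -(expect_right_mul hQ uU (bounded_measurable_indic R mA)).
rewrite le_eqVlt; apply/orP; left; apply/eqP; congr (expect Q _).
apply/funext => x; rewrite /= !indicE; congr (nat_of_bool _)%:R.
have c0 : 0 < normc c.
  rewrite cE lt_neqAle frob_ge0 andbT eq_sym; apply: contra dl0 => /eqP.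
  by move=> /frob_eq0 ->.
apply/idP/idP => /set_mem /= H; apply: mem_set => /=; move: H;
  by rewrite /lineval /A /= xE ComplexField.Normc.normcM -cE ler_pM2l//
    ler_sqr ?nnegrE ?normc_ge0.
Qed.

End SmallLinearForms.

(** * The exceptional event and the theorem *)

Section GoodEvent.
Context (R : realType) (d q : nat) (Q : probability (borelCvec R d) R).
Context (hQ : uniform_on_sphere Q) (hd : (2 <= d)%N).
Local Notation T := (borelCvec R d).
Local Notation normc := ComplexField.Normc.normc.

(** Union bound over the nonzero vectors of a finite family; those that vanish
    have to be left out, as their linear form is never large. The bound
    [(d - 1)^2 / r^2] of each term is rounded up to [(d - 1) d / r^2]. *)
Lemma prob_all_linear_forms_large (gap : 'I_q -> 'rV[R[i]]_d) (r : R) : 0 < r ->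
  exists2 W : set T, measurable W &
    (forall x, W x -> frob (x : 'rV[R[i]]_d) = 1 /\
      forall j, gap j != 0 ->
        frob (gap j) * r^-1 < normc (lineval (x : 'rV[R[i]]_d) (gap j))) /\
    1 - q%:R * (d%:R - 1) * d%:R / r ^+ 2 <= expect Q \1_W.
Proof.
move=> r0.
pose S := [set x : T | frob (x : 'rV[R[i]]_d) = 1].
have mS : measurable S by exact: measurable_sphere.
pose bad j : set T := if gap j == 0 then set0 else
  [set x : T | normc (lineval (x : 'rV[R[i]]_d) (gap j)) <= frob (gap j) * r^-1].
have mbad j : measurable (bad j).
  rewrite /bad; case: eqP => // _.
  rewrite [X in measurable X](_ : _ = [set x : T |
      normc (\sum_k (x : 'rV[R[i]]_d) 0 k * gap j 0 k) ^+ 2 <= (frob (gap j) * r^-1) ^+ 2]).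
    apply: measurable_set_le; last exact: measurable_cst.
    exact: measurable_sqr_normc_lin.
  apply/seteqP; split => x /=;
    by rewrite ler_sqr ?nnegrE ?normc_ge0// mulr_ge0 ?frob_ge0// invr_ge0 ltW.
have bb j : bounded_measurable (\1_(bad j) : T -> R) by exact: bounded_measurable_indic.
have bs := bounded_measurable_sum bb.
pose H := [set x : T | (1 : R) <= \sum_j \1_(bad j) x].
have mH : measurable H.
  by apply: measurable_set_le; [exact: measurable_cst | case: bs].
have mW : measurable (S `&` ~` H) by apply: measurableI => //; exact: measurableC.
exists (S `&` ~` H) => //; split.
  move=> x [xS xH]; split=> // j gj; rewrite ltNge; apply/negP => le.
  apply: xH; rewrite /H /= (bigD1 j)//=.
  have -> : \1_(bad j) x = 1 :> R.
    by rewrite indicE mem_set// /bad (negPf gj).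
  by rewrite lerDl sumr_ge0// => k _; rewrite indicE.
have mSC : measurable (~` S) by exact: measurableC.
have bW := bounded_measurable_indic R mW.
have bSC := bounded_measurable_indic R mSC.
have : expect Q (fun=> 1) <=
    expect Q (fun x => \1_(S `&` ~` H) x + (\1_(~` S) x + \sum_j \1_(bad j) x)).
  apply: le_expect.
  - exact: bounded_measurable_cst.
  - by apply: bounded_measurableD => //; exact: bounded_measurableD.
  have s0 x : 0 <= \sum_j \1_(bad j) x :> R.
    by apply: sumr_ge0 => j _; rewrite indicE.
  have i0 (A : set T) x : 0 <= \1_A x :> R by rewrite indicE.
  have i1 (A : set T) x : A x -> \1_A x = 1 :> R by move=> Ax; rewrite indicE mem_set.
  move=> x; have [xS|xS] := pselect (S x); last first.
    by rewrite addrCA (i1 (~` S))// lerDl addr_ge0.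
  have [xH|xH] := pselect (H x).
    by apply: (le_trans xH); rewrite addrA lerDr addr_ge0.
  by rewrite (i1 (S `&` ~` H))// lerDl addr_ge0.
rewrite expect_cst expectD//; last exact: bounded_measurableD.
rewrite expectD// expect_off_sphere// add0r expect_sum// => h.
have hb : \sum_j expect Q \1_(bad j) <= q%:R * (d%:R - 1) * d%:R / r ^+ 2.
  have d1 : 0 <= d%:R - 1 :> R by rewrite subr_ge0 ler1n (leq_trans _ hd).
  apply: le_trans (_ : \sum_(j < q) (d%:R - 1) * d%:R / r ^+ 2 <= _); last first.
    by rewrite sumr_const card_ord -[leLHS]mulr_natl !mulrA.
  apply: ler_sum => j _; rewrite /bad.
  have [_|gj] := eqVneq (gap j) 0.
    rewrite indic0 -[X in expect _ X]/(fun=> 0) expect_cst.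
    by apply: divr_ge0; [exact: mulr_ge0 | exact: sqr_ge0].
  apply: le_trans (prob_small_linear_form hQ hd gj _) _; first by rewrite invr_ge0 ltW.
  rewrite exprVn ler_wpM2r ?invr_ge0 ?sqr_ge0// expr2 ler_wpM2l//.
  by rewrite lerBlDr lerDl ler01.
rewrite lerBlDr; apply: le_trans h _.
by rewrite lerD2l.
Qed.

End GoodEvent.

Theorem theorem4p5 (R : realType) (d p q : nat)
    (A : 'I_d -> 'M[R[i]]_(p + q)) (lam : 'rV[R[i]]_d)
    (X1 Y1 : 'M[R[i]]_(p + q, p)) (X2 Y2 : 'M[R[i]]_(p + q, q))
    (A22 : 'I_d -> 'M[R[i]]_q)
    (E : 'I_d -> 'M[R[i]]_(p + q))
    (disp : measure_display) (Omega : measurableType disp)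
    (P : probability Omega R) (mu : {RV P >-> borelCvec R d})
    (hd : (2 <= d)%N)
    (hcomm : commuting_family A)
    (hdiag : simultaneously_diagonalizable A)
    (hlam : semisimple_joint_eigenvalue A lam p)
    (hX : row_mx X1 X2 \in unitmx)
    (hY : row_mx Y1 Y2 \in unitmx)
    (hX1 : X1 ^t* *m X1 = 1%:M)
    (hYX : (row_mx Y1 Y2) ^t* *m row_mx X1 X2 = 1%:M)
    (hYAX : forall k : 'I_d, (row_mx Y1 Y2) ^t* *m A k *m row_mx X1 X2 =
              block_mx (lam 0 k)%:M 0 0 (A22 k))
    (hA22 : forall k : 'I_d, is_diag_mx (A22 k))
    (hE : \sum_(k < d) frob (E k) ^+ 2 = 1)
    (hmu : uniform_on_sphere (distribution P mu))
    (hss : {ae P, forall w : Omega, \forall e \near (0 : R)^'+,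
              exists theta : 'rV[R[i]]_p,
                closest_semisimple (lincomb (mu w) (perturb A E e))
                  (lineval (mu w) lam) theta})
    (r : R) (hr : 0 < r) (i : 'I_p) :
  exists B : set Omega,
    [/\ measurable B,
        B `<=` [set w | exists C : R, forall e : R, 0 < e ->
          forall (theta : 'rV[R[i]]_p) (Xt Yt : 'M[R[i]]_(p + q, p)),
            closest_semisimple (lincomb (mu w) (perturb A E e))
              (lineval (mu w) lam) theta ->
            normalized_eigenvectors (lincomb (mu w) (perturb A E e))
              theta Xt Yt ->
            frob (rayleigh (perturb A E e) (col i Xt) - lam)
              <= (1 + specnorm X2 * specnorm Y2 * r) * e + C * e ^+ 2] &
        ((1 - (q%:R * (d%:R - 1) * d%:R) / r ^+ 2)%:E <= P B)%E].
Proof.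
have [W mW [hW PW]] := prob_all_linear_forms_large hmu hd (eig_gap lam A22) hr.
have mB : measurable (mu @^-1` W).
  by rewrite -[X in measurable X]setTI; exact: measurable_funP.
exists (mu @^-1` W); split => //.
  move=> w /hW[mu1 gapw]; rewrite /mkset.
  exact: (rayleigh_error_bound hYX hYAX hA22 hE mu1 i hr gapw).
by rewrite -[P _]/(distribution P mu W) -expect_indic.
Qed.
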